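(* Every real matrix $A\in\mathbb{R}^{4\times4}$ has at most $23$ distinct Pareto eigenvalues, and this bound is attained by some $A\in\mathbb{R}^{4\times 4}$. Equivalently, $c_4=23$.
   Context: For $A\in\mathbb{R}^{n\times n}$, a real number $\lambda$ is a Pareto eigenvalue of $A$ if there exists $x\in\mathbb{R}^n\setminus\{0\}$ with $x\ge 0$, $Ax-\lambda x\ge 0$ (componentwise) and $\langle x,Ax-\lambda x\rangle=0$. The set of Pareto eigenvalues of $A$ is denoted $\Pi(A)$. The Pareto capacity of order $n$ is $c_n:=\max_{A\in\mathbb{R}^{n\times n}}|\Pi(A)|$. *)

(* Defs.v *)
From HB Require Import structures.
From mathcomp Require Import all_boot all_order all_algebra.
From mathcomp Require Import boolp classical_sets functions cardinality reals.

Set Implicit Arguments.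
Unset Strict Implicit.
Unset Printing Implicit Defensive.

Import Order.TTheory GRing.Theory Num.Theory.
Local Open Scope classical_set_scope.
Local Open Scope card_scope.
Local Open Scope ring_scope.

Section Pareto.
Variables (R : realType) (n : nat).

Definition nonneg_vec (v : 'cV[R]_n) : Prop := forall i, 0 <= v i 0.

Definition inner_prod (u v : 'cV[R]_n) : R := \sum_i u i 0 * v i 0.

Definition pareto_eigenvalue (A : 'M[R]_n) (lambda : R) : Prop :=
  exists x : 'cV[R]_n,
    [/\ x != 0, nonneg_vec x, nonneg_vec (A *m x - lambda *: x)
      & inner_prod x (A *m x - lambda *: x) = 0].

Definition pareto_spectrum (A : 'M[R]_n) : set R :=
  [set lambda | pareto_eigenvalue A lambda].

End Pareto.

Definition is_pareto_capacity (R : realType) (n c : nat) : Prop :=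
  (forall A : 'M[R]_n, pareto_spectrum A #<= `I_c) /\
  (exists A : 'M[R]_n, pareto_spectrum A #= `I_c).

(* The default value 0 is only returned when the maximum does not exist; when it
   exists it is unique, since it is the cardinality of a set of maximal size. *)
Definition pareto_capacity (R : realType) (n : nat) : nat :=
  xget 0%N [set c | is_pareto_capacity R n c].

(* Main.v *)
Require Import Defs.
From HB Require Import structures.
From mathcomp Require Import all_boot all_order all_algebra.
From mathcomp Require Import boolp classical_sets functions cardinality reals.
From mathcomp Require Import finmap zify ring lra.

(** Gluing a vector supported by [J] and its slack, supported by the complement of [J], into a
   single vector [z], one sees that [l] is a Pareto eigenvalue of [A] iff [cmx A J l *m z = 0]
   for some [J] and some nonzero [z >= 0], where [cmx A J l] has column [l e_j - A e_j] for
   [j] in [J] and [e_j] otherwise.  When [l] is not an eigenvalue of a principal submatrix, the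
   signed number of sets [J] for which [cmx A J l *m z = q] has a positive solution does not
   depend on the generic vector [q]; call it the degree at [l].

   The degree goes from 1 near minus infinity to 0 near plus infinity and only changes at
   Pareto eigenvalues.  Say that a set [J] uses an even position at [a] if [a] is, for instance,
   the second or the fourth smallest eigenvalue of the submatrix indexed by [J].  At a Pareto
   eigenvalue [a] the jump [d] of the degree satisfies [1 + d <= 2 e], where [e] is the number of
   even positions used at [a].  Summing over the [N] Pareto eigenvalues, [N <= 2 E + 1] where [E],
   the total number of used even positions, is at most 6 + 4 + 2 = 12 in order four.

   If [N >= 24], then [E = 12] and at most one jump is zero.  A nonzero jump survives a small
   perturbation of [A], and the perturbation can be chosen so as to preserve the possible
   Pareto eigenvalue of zero jump and to make [A] generic.  So [A] may be assumed generic, with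
   all twelve even positions used.  The larger eigenvalue of every pair being used, [A i j > 0]
   whenever [A i i <= A j j] and [i != j], and two entries of the row of the largest diagonal
   entry are not both negative.  The middle eigenvalue of every triple being used, they are not
   both positive either.  This is absurd, as that row has three off-diagonal entries. *)

Set Implicit Arguments.
Unset Strict Implicit.
Unset Printing Implicit Defensive.

Import Order.TTheory GRing.Theory Num.Theory.
Local Open Scope ring_scope.

(** * Roots of real polynomials *)

Section PolyRoots.
Variable R : rcfType.
Implicit Types (p : {poly R}) (a b x y : R).

Lemma poly_split p : p != 0 ->
  exists (s : seq R) (h : {poly R}),
    p = h * \prod_(a <- s) ('X - a%:P) /\ forall x, ~~ root h x.
Proof.
elim: {p}(size p) {-2}p (leqnn (size p)) => [|m IH] p sp p0.
  by move: sp; rewrite leqn0 size_poly_eq0 (negPf p0).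
have [[a pa]|nr] := pselect (exists a, root p a); last first.
  exists [::], p; rewrite big_nil mulr1; split => // x.
  by apply/negP => px; apply: nr; exists x.
have /factor_theorem [q pq] := pa.
have q0 : q != 0 by apply: contraNneq p0 => q0; rewrite pq q0 mul0r.
have sq : (size q <= m)%N.
  by move: sp; rewrite pq size_Mmonic ?monicXsubC// size_XsubC addn2.
have [s [h [qe hr]]] := IH q sq q0.
by exists (a :: s), h; split => //; rewrite pq qe big_cons; ring.
Qed.

Lemma seq_isolated (s : seq R) a :
  exists2 e, 0 < e & forall x, x \in s -> x != a -> e <= `|x - a|.
Proof.
elim: s => [|b s [e e0 IH]]; first by exists 1.
exists (if b == a then e else Num.min e `|b - a|).
  case: eqVneq => // ba; rewrite lt_min e0 normr_gt0 subr_eq0 ba //.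
move=> x; rewrite inE => /orP[/eqP -> ba|xs xa].
  by rewrite (negPf ba) ge_min lexx orbT.
by case: eqVneq => _; rewrite ?ge_min IH.
Qed.

Lemma poly_isolated p a : p != 0 ->
  exists2 e, 0 < e & forall x, `|x - a| < e -> x != a -> p.[x] != 0.
Proof.
move=> /poly_split [s [h [-> hr]]].
have [e e0 he] := seq_isolated s a; exists e => // x xe xa.
rewrite -/(root _ x) rootM (negPf (hr x)) root_prod_XsubC /=.
by apply/negP => xs; have := he x xs xa; rewrite leNgt xe.
Qed.

Lemma sgz_noroot p x y : x <= y -> (forall z, x <= z <= y -> p.[z] != 0) ->
  sgz p.[x] = sgz p.[y].
Proof.
move=> xy nr.
have key (q : {poly R}) : (forall z, x <= z <= y -> q.[z] != 0) ->
    0 < q.[y] -> 0 < q.[x].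
  move=> qn qy; rewrite lt_def qn ?lexx//=; rewrite leNgt; apply/negP => qx.
  have [|z zxy /eqP qz] := @poly_ivt _ q x y xy; first by rewrite !ltW.
  by have := qn z zxy; rewrite qz eqxx.
have nrN : forall z, x <= z <= y -> (- p).[z] != 0.
  by move=> z zx; rewrite hornerN oppr_eq0 nr.
have := nr x; have := nr y; rewrite !lexx xy => /(_ isT) + /(_ isT).
case: (ltgtP p.[y] 0) => // py _; case: (ltgtP p.[x] 0) => // px _.
- by rewrite !ltr0_sgz.
- by have := key (- p) nrN; rewrite !hornerN !oppr_gt0 py => /(_ isT); rewrite ltNge ltW.
- by have := key p nr py; rewrite ltNge ltW.
- by rewrite !gtr0_sgz.
Qed.

Definition has_jump (g : R -> int) a (d : int) := exists2 e, 0 < e &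
  forall x y, a - e < x -> x < a -> a < y -> y < a + e -> g y - g x = d.

(** By induction on the number of points of [s] inside the interval: cut out a small neighbourhood
    of one of them, which contributes [d c], and treat both sides by induction. *)
Lemma jump_sum (s : seq R) (g : R -> int) (d : R -> int) : uniq s ->
  (forall a, a \in s -> has_jump g a (d a)) ->
  (forall x y, x <= y -> (forall z, x <= z <= y -> z \notin s) -> g x = g y) ->
  forall a b, a <= b -> a \notin s -> b \notin s ->
  g b - g a = \sum_(c <- s | a < c < b) d c.
Proof.
move=> us hj hc a b.
have [m] := ubnP (count (fun c => a < c < b) s).
elim: m a b => // m IH a b cm ab as_ bs.
have [/hasP [c cs /andP[ac cb]]|/hasPn none] := boolP (has (fun c => a < c < b) s);
  last first.
  rewrite big_seq_cond big_pred0; last first.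
    by move=> c; apply/negP => /andP[/none/negP h h']; apply: h.
  rewrite (hc a b ab) ?subrr// => z /andP[az zb]; apply/negP => zs.
  have := none z zs; rewrite !lt_neqAle az zb !andbT negb_and !negbK.
  by case/orP => /eqP e; [move: as_; rewrite e zs|move: bs; rewrite -e zs].
have [e1 e10 he1] := hj c cs.
have [e2 e20 he2] := seq_isolated (a :: b :: s) c.
(* This radius is below the range of the jump at [c] and below the distance from [c] to [a], to [b]
   and to the other points of [s]. *)
set e := Num.min e1 e2 / 2.
have e0 : 0 < e by rewrite divr_gt0// lt_min e10.
have ee1 : e < e1.
  by rewrite /e ltr_pdivrMr// (le_lt_trans (y := e1)) ?ge_min ?lexx//; lra.
have ee2 : e < e2.
  by rewrite /e ltr_pdivrMr// (le_lt_trans (y := e2)) ?ge_min ?lexx ?orbT//; lra.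
have far z : z \in a :: b :: s -> z != c -> z <= c - e2 \/ c + e2 <= z.
  move=> zs zc; have := he2 z zs zc; rewrite ler_normr => /orP[]h; [right|left]; lra.
have ax : a <= c - e.
  by have [|||] := far a; rewrite ?inE ?eqxx ?lt_eqF//; lra.
have yb : c + e <= b.
  by have [|||] := far b; rewrite ?inE ?eqxx ?orbT ?gt_eqF//; lra.
have nx : c - e \notin s.
  apply/negP => zs; have [|||] := far (c - e); rewrite ?inE ?zs ?orbT//; last by lra.
  - by rewrite lt_eqF//; lra.
  - by lra.
have ny : c + e \notin s.
  apply/negP => zs; have [|||] := far (c + e); rewrite ?inE ?zs ?orbT//; last by lra.
  - by rewrite gt_eqF//; lra.
  - by lra.
have -> : g b - g a = (g b - g (c + e)) + (g (c + e) - g (c - e)) + (g (c - e) - g a)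
  by ring.
rewrite (he1 (c - e) (c + e)); try lra.
have part z : z \in s -> (if a < z < b then d z else 0) =
    (if c + e < z < b then d z else 0) + (if z == c then d z else 0)
      + (if a < z < c - e then d z else 0).
  move=> zs; case: eqVneq => [->|zc].
    have -> : (c + e < c) = false by apply/negP; lra.
    have -> : (c < c - e) = false by apply/negP; lra.
    by rewrite ac cb andbF addr0 add0r.
  have [||h|h] := far z; rewrite ?inE ?zs ?orbT//.
    have -> : (z < b) by lra. have -> : (z < c - e) by lra.
    have -> : (c + e < z) = false by apply/negP; lra.
    by rewrite !addr0 add0r.
  have -> : (a < z) by lra. have -> : (c + e < z) by lra.
  have -> : (z < c - e) = false by apply/negP; lra.
  by rewrite !addr0.
have lt1 (P : pred R) : (forall z, P z -> (a < z < b)) -> ~~ P c ->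
    (count P s < m)%N.
  move=> PP nPc; rewrite -ltnS; apply: leq_trans cm; rewrite ltnS.
  have <- : count (predU P (pred1 c)) s = (count P s).+1.
    have := count_predUI P (pred1 c) s; rewrite (count_uniq_mem _ us) cs.
    have -> : count (predI P (pred1 c)) s = 0%N.
      apply/eqP; rewrite -leqn0 leqNgt -has_count.
      by apply/negP => /hasP[z _ /andP[Pz /eqP zc]]; move: nPc; rewrite -zc Pz.
    by rewrite addn0 addn1.
  by apply: sub_count => z /orP[/PP//|/eqP ->]; rewrite ac.
rewrite (IH (c + e) b)//; last by apply: lt1; [move=> z|apply/negP]; lra.
rewrite (IH a (c - e))//; last by apply: lt1; [move=> z|apply/negP]; lra.
rewrite (big_mkcond (fun c => a < c < b)) (eq_big_seq _ part) !big_split/=; rewrite -(big_mkcond (fun z => c + e < z < b)) -(big_mkcond (fun z => a < z < c - e))/=.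
rewrite (bigD1_seq c (F := fun z => if z == c then d z else 0))//= eqxx.
rewrite [X in _ + (_ + X) + _]big1 ?addr0// => z /negPf -> //.
Qed.
End PolyRoots.

(** * Complementary matrices *)


Section Complementary.
Variable n : nat.

Definition cmx (K : comNzRingType) (A : 'M[K]_n) (J : {set 'I_n}) (l : K) : 'M[K]_n :=
  \matrix_(i, j) (if j \in J then l *+ (i == j) - A i j else (i == j)%:R).

Definition cdet (K : comNzRingType) (A : 'M[K]_n) J l : K := \det (cmx A J l).

(** This is [cdet] times the solution of [cmx A J l *m z = q]. Unlike the solution, it is polynomial
    in the data and makes sense where the determinant vanishes. *)
Definition cvec (K : comNzRingType) (A : 'M[K]_n) J l (q : 'cV[K]_n) : 'cV[K]_n := \adj (cmx A J l) *m q.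

Definition flip (i : 'I_n) (J : {set 'I_n}) : {set 'I_n} :=
  finset (fun j => (j == i) (+) (j \in J)).

Lemma flipK i : involutive (flip i).
Proof. by move=> J; apply/setP => j; rewrite !inE addbA addbb. Qed.

Lemma in_flip i J j : j != i -> (j \in flip i J) = (j \in J).
Proof. by rewrite inE => /negPf ->. Qed.

Lemma sign_flip (K : nzRingType) i J : (-1) ^+ #|flip i J| = - (-1) ^+ #|J| :> K.
Proof.
have [iJ|iJ] := boolP (i \in J).
  have -> : flip i J = J :\ i.
    by apply/setP => j; rewrite !inE; case: eqVneq => // ->; rewrite iJ.
  by rewrite [in RHS](cardsD1 i) iJ exprS mulN1r opprK.
have -> : flip i J = i |: J.
  by apply/setP => j; rewrite !inE; case: eqVneq => // ->; rewrite (negPf iJ).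
by rewrite cardsU1 iJ exprS mulN1r.
Qed.

Section Map.
Variables (K K' : comNzRingType) (f : {rmorphism K -> K'}).

Lemma cmx_map A J l : map_mx f (cmx A J l) = cmx (map_mx f A) J (f l).
Proof.
by apply/matrixP => i j; rewrite !mxE; case: ifP => _; rewrite ?rmorphB ?rmorphMn ?rmorph1.
Qed.

Lemma cdet_map A J l : f (cdet A J l) = cdet (map_mx f A) J (f l).
Proof. by rewrite /cdet -cmx_map det_map_mx. Qed.

Lemma cvec_map A J l q i : f (cvec A J l q i 0) = cvec (map_mx f A) J (f l) (map_mx f q) i 0.
Proof. by rewrite /cvec -cmx_map -map_mx_adj -map_mxM [in RHS]mxE. Qed.

End Map.

Section Ring.
Variable K : comNzRingType.
Implicit Types (A : 'M[K]_n) (J : {set 'I_n}) (l : K) (q z : 'cV[K]_n).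

Lemma mul_cmx_cvec A J l q : cmx A J l *m cvec A J l q = cdet A J l *: q.
Proof. by rewrite /cvec mulmxA mul_mx_adj mul_scalar_mx. Qed.

Lemma cvec_mul_cmx A J l z : cvec A J l (cmx A J l *m z) = cdet A J l *: z.
Proof. by rewrite /cvec mulmxA mul_adj_mx mul_scalar_mx. Qed.

Lemma cmx_mulE A J l z r : (cmx A J l *m z) r 0 =
  (if r \in J then l * z r 0 else z r 0) - \sum_(k in J) A r k * z k 0.
Proof.
have E k : cmx A J l r k * z k 0 = (if k == r then if r \in J then l * z r 0 else z r 0 else 0)
    - (if k \in J then A r k * z k 0 else 0).
  rewrite mxE eq_sym; case: eqVneq => [->|_]; case: ifP => _; rewrite ?mulr1n ?mulr0n; ring.
by rewrite mxE (eq_bigr _ (fun k _ => E k)) sumrB -!big_mkcond /= big_pred1_eq.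
Qed.

(* Cramer: the [i]-th entry of [cvec] does not see the [i]-th column of [cmx]. *)
Lemma cvec_flip A J l q i : cvec A (flip i J) l q i 0 = cvec A J l q i 0.
Proof.
rewrite /cvec !mxE; apply: eq_bigr => k _; rewrite ![\adj _ _ _]mxE /cofactor.
congr (_ * \det _ * _).
by apply/matrixP => r c; rewrite !mxE in_flip // eq_sym neq_lift.
Qed.

Lemma mul_cmx_flip A J l z i : z i 0 = 0 -> cmx A (flip i J) l *m z = cmx A J l *m z.
Proof.
move=> zi; apply/colP => r; rewrite !mxE; apply: eq_bigr => c _; rewrite !mxE.
by case: (eqVneq c i) => [->|ci]; rewrite ?zi ?mulr0// in_flip.
Qed.

End Ring.

(** A solution with zero [i]-th entry ignores column [i], so it also solves the system of
    [flip i J]; Cramer's rule gives the ratio. *)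
Lemma cvec_flip_prop (K : idomainType) (A : 'M[K]_n) J l q i :
  cdet A J l != 0 -> cvec A J l q i 0 = 0 ->
  cdet A J l *: cvec A (flip i J) l q = cdet A (flip i J) l *: cvec A J l q.
Proof.
move=> d0 z0.
have := mul_cmx_cvec A J l q; rewrite -(mul_cmx_flip _ _ _ z0) => e.
have := cvec_mul_cmx A (flip i J) l (cvec A J l q); rewrite e => <-.
by rewrite /cvec scalemxAr.
Qed.

Lemma cmx_kernel_cdet (K : fieldType) (A : 'M[K]_n) J l (z : 'cV[K]_n) :
  z != 0 -> cmx A J l *m z = 0 -> cdet A J l = 0.
Proof.
move=> z0 Mz; have := cvec_mul_cmx A J l z; rewrite Mz /cvec mulmx0 => /esym/eqP.
by rewrite scaler_eq0 (negPf z0) orbF => /eqP.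
Qed.

Lemma cV_neq0_ex (V : nmodType) (z : 'cV[V]_n) : z != 0 -> exists i, z i 0 != 0.
Proof.
move=> z0; apply: contrapT => h; case/negP: z0; apply/eqP/colP => i; rewrite mxE.
by apply/eqP/negPn/negP => k; apply: h; exists i.
Qed.

End Complementary.

(** * The degree *)


Section Near.
Variable R : rcfType.
Implicit Types (p : {poly R}) (a x : R) (P Q : R -> Prop).

Definition nearp a P := exists2 e, 0 < e & forall x, `|x - a| < e -> P x.

Lemma nearpW a P Q : (forall x, P x -> Q x) -> nearp a P -> nearp a Q.
Proof. by move=> PQ [e e0 h]; exists e => // x /h /PQ. Qed.

Lemma nearp_and a P Q : nearp a P -> nearp a Q -> nearp a (fun x => P x /\ Q x).
Proof.
move=> [e e0 h] [f f0 k]; exists (Num.min e f); first by rewrite lt_min e0.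
by move=> x; rewrite lt_min => /andP[/h + /k].
Qed.

Lemma nearp_all (T : finType) a (P : T -> R -> Prop) :
  (forall t, nearp a (P t)) -> nearp a (fun x => forall t, P t x).
Proof.
move=> h; suff: nearp a (fun x => forall t, t \in enum T -> P t x).
  by apply: nearpW => x k t; apply: k; rewrite mem_enum.
elim: (enum T) => [|t s IH]; first by exists 1.
apply: nearpW (nearp_and (h t) IH) => x [Pt Ps] u; rewrite inE.
by case/orP => [/eqP ->//|/Ps].
Qed.

Lemma nearp_sgz p a : p.[a] != 0 -> nearp a (fun x => sgz p.[x] = sgz p.[a]).
Proof.
move=> pa; have p0 : p != 0 by apply: contraNneq pa => ->; rewrite horner0.
have [e e0 he] := poly_isolated a p0; exists e => // x xe.
have nr z : `|z - a| < e -> p.[z] != 0.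
  by move=> ze; case: (eqVneq z a) => [->//|]; apply: he.
have [xa|ax] := leP x a.
  apply: sgz_noroot => // z /andP[xz za]; apply: nr; move: xe; rewrite !ltr_norml; lra.
symmetry; apply: sgz_noroot; rewrite ?(ltW ax)// => z /andP[xz za]; apply: nr.
by move: xe; rewrite !ltr_norml; lra.
Qed.

Lemma nearp_neq0 p a : p != 0 -> nearp a (fun x => x != a -> p.[x] != 0).
Proof. by move=> /(poly_isolated a) [e e0 he]; exists e => // x /he. Qed.

Lemma nearp_ex a P : nearp a P -> forall e, 0 < e -> exists2 x, a < x < a + e & P x.
Proof.
move=> [f f0 h] e e0; exists (a + Num.min e f / 2).
  have : 0 < Num.min e f <= e by rewrite lt_min e0 f0 ge_min lexx.
  by lra.
apply: h; rewrite addrC addKr ger0_norm.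
  have : 0 < Num.min e f <= f by rewrite lt_min e0 f0 ge_min lexx orbT.
  by lra.
by apply: divr_ge0 => //; rewrite le_min !ltW.
Qed.

End Near.

Section Degree.
Variables (R : rcfType) (n : nat).
Implicit Types (J : {set 'I_n}).

(** With [cdet] for [d] and [cvec] for [z], the test says that the solution is positive, and the
    sign is that of the principal minor of [A - l] indexed by [J]. *)
Definition sterm (d : R) (z : 'I_n -> R) J : int :=
  if [forall i, 0 < sgz d * sgz (z i)] then (-1) ^+ #|J| * sgz d else 0.

Lemma sterm_near (d : {poly R}) (z : 'I_n -> {poly R}) a J : d.[a] != 0 ->
  (forall i, (z i).[a] != 0) ->
  nearp a (fun x => sterm d.[x] (fun i => (z i).[x]) J = sterm d.[a] (fun i => (z i).[a]) J).
Proof.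
move=> d0 z0; have := nearp_and (nearp_sgz d0) (nearp_all (fun i => nearp_sgz (z0 i))).
apply: nearpW => x [dx zx]; rewrite /sterm dx.
by congr (if _ then _ else _); apply: eq_forallb => i; rewrite zx.
Qed.

Lemma forallb_split (d : int) (z : 'I_n -> R) i : [forall j, 0 < d * sgz (z j)] =
  (0 < d * sgz (z i)) && [forall j, (j != i) ==> (0 < d * sgz (z j))].
Proof.
apply/forallP/andP => [h|[h /forallP k] j]; last first.
  by case: (eqVneq j i) => [->//|ji]; have := k j; rewrite ji.
by split => //; apply/forallP => j; rewrite h implybT.
Qed.

Lemma prop_sign (d d' z z' : R) : d != 0 -> d' != 0 -> d * z' = d' * z ->
  (0 < sgz d' * sgz z') = (0 < sgz d * sgz z).
Proof.
move=> d0 d0' e; rewrite -!sgzM !sgz_gt0.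
have pos : d ^+ 2 * (d' * z') = d' ^+ 2 * (d * z).
  transitivity (d * d' * (d * z')); first by ring.
  by rewrite e; ring.
have : (0 < d ^+ 2 * (d' * z')) = (0 < d' ^+ 2 * (d * z)) by rewrite pos.
have h : 0 < d ^+ 2 by rewrite exprn_even_gt0.
have h' : 0 < d' ^+ 2 by rewrite exprn_even_gt0.
by rewrite (pmulr_rgt0 _ h) (pmulr_rgt0 _ h').
Qed.

(* When one coordinate of the solution attached to [J] crosses zero, the solution
   attached to [flip i J] crosses zero as well, and the two signed terms compensate. *)
Lemma sterm_cross (D : {set 'I_n} -> {poly R}) (Z : {set 'I_n} -> 'I_n -> {poly R}) a :
  (forall J, (D J).[a] != 0) -> (forall J i, Z J i != 0) ->
  (forall J i, Z (flip i J) i = Z J i) ->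
  (forall J i, (Z J i).[a] = 0 -> forall j,
    (D J).[a] * (Z (flip i J) j).[a] = (D (flip i J)).[a] * (Z J j).[a]) ->
  (forall J i j, (Z J i).[a] = 0 -> (Z J j).[a] = 0 -> i = j) ->
  exists c, nearp a (fun x => x != a ->
    \sum_J sterm (D J).[x] (fun i => (Z J i).[x]) J = c).
Proof.
move=> d0 z0 zf prop zu.
(* [phi] exchanges two sets whose solutions have the same vanishing entry at [a], and fixes the sets
   without vanishing entry. *)
pose phi J := if [pick i | (Z J i).[a] == 0] is Some i then flip i J else J.
have prop0 J i : (Z J i).[a] = 0 -> forall j,
    ((Z (flip i J) j).[a] == 0) = ((Z J j).[a] == 0).
  move=> zi j; have := prop J i zi j => e.
  have e2 : ((D J).[a] * (Z (flip i J) j).[a] == 0) = ((D (flip i J)).[a] * (Z J j).[a] == 0).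
    by rewrite e.
  by move: e2; rewrite !mulf_eq0 !(negPf (d0 _)).
have phiK : involutive phi.
  move=> J; rewrite {2}/phi; case: pickP => [i zi|nz].
    rewrite /phi; case: pickP => [j|/(_ i)]; rewrite (prop0 J i (eqP zi)) ?zi// => zj.
    by rewrite (zu J j i (eqP zj) (eqP zi)) flipK.
  by rewrite /phi; case: pickP => // j; rewrite nz.
pose t J x := sterm (D J).[x] (fun i => (Z J i).[x]) J.
have key J : exists c, nearp a (fun x => x != a -> t J x + t (phi J) x = c).
  rewrite /phi; case: pickP => [i /eqP zi|nz]; last first.
    exists (t J a + t J a); have := sterm_near J (d0 J) (fun i => negbT (nz i)).
    by apply: nearpW => x e _; rewrite /t e.
  pose J' := flip i J.
  pose O := [forall j, (j != i) ==> (0 < sgz (D J).[a] * sgz (Z J j).[a])].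
  (* If both determinants have the same sign, the two solutions are positive on the same side of [a]
     and their terms cancel. Otherwise exactly one of them is positive on each side, with the same
     contribution. [O] tells whether the other entries allow positivity. *)
  exists ((-1) ^+ #|J| * (if O then ((0 < sgz (D J).[a])%R : nat)%:Z - ((0 < sgz (D J').[a])%R : nat)%:Z else 0)).
  have nzj j : j != i -> (Z J j).[a] != 0.
    by move=> ji; apply: contraNneq ji => e; apply/eqP/(zu J j i e zi).
  have nzj' j : j != i -> (Z J' j).[a] != 0 by move=> ji; rewrite prop0// nzj.
  have H1 := nearp_and (nearp_sgz (d0 J)) (nearp_sgz (d0 J')).
  have H2 : nearp a (fun x => forall j, j != i -> sgz (Z J j).[x] = sgz (Z J j).[a]).
    apply: nearp_all => j; case: (eqVneq j i) => [_|ji]; first by exists 1.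
    by apply: nearpW (nearp_sgz (nzj j ji)).
  have H2' : nearp a (fun x => forall j, j != i -> sgz (Z J' j).[x] = sgz (Z J' j).[a]).
    apply: nearp_all => j; case: (eqVneq j i) => [_|ji]; first by exists 1.
    by apply: nearpW (nearp_sgz (nzj' j ji)).
  have H3 := nearp_neq0 a (z0 J i).
  apply: nearpW (nearp_and H1 (nearp_and (nearp_and H2 H2') H3)).
  move=> x [[d1 d2] [[z1 z2] z3]] xa; rewrite /t /sterm d1 d2.
  have zi0 := z3 xa.
  rewrite (forallb_split _ _ i) (forallb_split (sgz (D J').[a]) _ i).
  have -> : [forall j, (j != i) ==> (0 < sgz (D J).[a] * sgz (Z J j).[x])] = O.
    by apply: eq_forallb => j; case: eqVneq => //= ji; rewrite -z1.
  have -> : [forall j, (j != i) ==> (0 < sgz (D J').[a] * sgz (Z J' j).[x])] = O.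
    by apply: eq_forallb => j; case: eqVneq => //= ji; rewrite z2// (prop_sign (d0 J) (d0 J') (prop J i zi j)).
  rewrite zf sign_flip.
  case: O; rewrite ?andbF ?andbT ?mulr0 ?addr0//.
  have sg (y : R) : y != 0 -> sgz y = 1 \/ sgz y = -1.
    by case: (ltgtP y 0) => // h _; [right; rewrite ltr0_sgz|left; rewrite gtr0_sgz].
  have [->|->] := sg _ (d0 J); have [->|->] := sg _ (d0 J'); have [->|->] := sg _ zi0;
    rewrite ?mulr1 ?mul1r ?mulrN1 ?mulN1r ?opprK //=; ring.
have [c hc] := choice key.
have H := nearp_all hc.
pose S x := \sum_J t J x.
have deg2 x : S x *+ 2 = \sum_J (t J x + t (phi J) x).
  by rewrite big_split/= mulr2n; congr (_ + _); rewrite /S (reindex_inj (inv_inj phiK)).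
have [e e0 he] := H.
exists (S (a + e / 2)); exists e => // x xe xa; rewrite -/(S x).
have : `|a + e / 2 - a| < e by rewrite addrC addKr ger0_norm; lra.
move=> /he h2; have ae : a + e / 2 != a by rewrite gt_eqF//; lra.
have e1 : S x *+ 2 = \sum_J c J by rewrite deg2; apply: eq_bigr => J _; apply: he.
have : S (a + e / 2) *+ 2 = \sum_J c J by rewrite deg2; apply: eq_bigr => J _; apply: h2.
by rewrite -e1 !mulr2n; lia.
Qed.

Definition term (A : 'M[R]_n) l (q : 'cV[R]_n) J : int :=
  sterm (cdet A J l) (fun i => cvec A J l q i 0) J.

(* The degree of the piecewise linear map attached to [A - l], computed at [q]
   as a signed count of its preimages. *)
Definition deg A l q : int := \sum_(J : {set 'I_n}) term A l q J.

Definition nonsing (A : 'M[R]_n) l := forall J, cdet A J l != 0.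

Definition generic (A : 'M[R]_n) l q := forall J i, cvec A J l q i 0 != 0.

(** The matrix, [l] and [q] all move polynomially along a path, so that every determinant is a
    polynomial in the path parameter. *)
Definition mev m k (A : 'M[{poly R}]_(m, k)) (x : R) := map_mx (horner_eval x) A.

Section Path.
Variables (A : 'M[{poly R}]_n) (l : {poly R}) (q : 'cV[{poly R}]_n).

Lemma cdet_ev J x : cdet (mev A x) J l.[x] = (cdet A J l).[x].
Proof. by rewrite /mev -[l.[x]]/(horner_eval x l) -cdet_map. Qed.

Lemma cvec_ev J x i : cvec (mev A x) J l.[x] (mev q x) i 0 = (cvec A J l q i 0).[x].
Proof. by rewrite /mev -[l.[x]]/(horner_eval x l) -cvec_map. Qed.

Lemma termE J x : term (mev A x) l.[x] (mev q x) J =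
  sterm (cdet A J l).[x] (fun i => (cvec A J l q i 0).[x]) J.
Proof.
rewrite /term /sterm cdet_ev.
by congr (if _ then _ else _); apply: eq_forallb => i; rewrite cvec_ev.
Qed.

Lemma near_deg a : nonsing (mev A a) l.[a] -> generic (mev A a) l.[a] (mev q a) ->
  nearp a (fun x => [/\ nonsing (mev A x) l.[x], generic (mev A x) l.[x] (mev q x) &
    deg (mev A x) l.[x] (mev q x) = deg (mev A a) l.[a] (mev q a)]).
Proof.
move=> d0 z0.
have d0' J : (cdet A J l).[a] != 0 by rewrite -cdet_ev.
have z0' J i : (cvec A J l q i 0).[a] != 0 by rewrite -cvec_ev.
have H1 := nearp_all (fun J => nearp_sgz (d0' J)).
have H2 := nearp_all (fun J => nearp_all (fun i => nearp_sgz (z0' J i))).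
have H3 := nearp_all (fun J => sterm_near J (d0' J) (z0' J)).
apply: nearpW (nearp_and (nearp_and H1 H2) H3) => x [[h1 h2] h3]; split.
- by move=> J; rewrite cdet_ev -sgz_eq0 h1 sgz_eq0.
- by move=> J i; rewrite cvec_ev -sgz_eq0 h2 sgz_eq0.
- by apply: eq_bigr => J _; rewrite !termE h3.
Qed.

Lemma deg_cross a : (forall J, (cdet A J l).[a] != 0) ->
  (forall J i, cvec A J l q i 0 != 0) ->
  (forall J i j, (cvec A J l q i 0).[a] = 0 -> (cvec A J l q j 0).[a] = 0 -> i = j) ->
  exists c, nearp a (fun x => x != a -> deg (mev A x) l.[x] (mev q x) = c).
Proof.
move=> d0 z0 zu; have [||c] := sterm_cross d0 z0 _ _ zu.
- by move=> J i; rewrite cvec_flip.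
- move=> J i zi j; rewrite -!cdet_ev -!cvec_ev.
  have := @cvec_flip_prop n R (mev A a) J l.[a] (mev q a) i.
  rewrite cdet_ev => /(_ (d0 J) (etrans (cvec_ev J a i) zi)) /colP/(_ j).
  by rewrite mxE [in RHS]mxE -cdet_ev => ->.
- move=> H; exists c; apply: nearpW H => x h xa; rewrite -h//.
  by apply: eq_bigr => J _; rewrite termE.
Qed.

End Path.
End Degree.


(** * Independence of the degree from the right-hand side *)

Section Independence.
Variables (R : rcfType) (n : nat).
Implicit Types (J : {set 'I_n}) (A : 'M[R]_n) (q : 'cV[R]_n) (l : R).

Lemma polys_avoid (T : finType) (P : T -> {poly R}) : (forall t, P t != 0) ->
  forall a, nearp a (fun x => x != a -> forall t, (P t).[x] != 0).
Proof.
move=> P0 a; have := nearp_all (fun t => nearp_neq0 a (P0 t)).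
by apply: nearpW => x h xa t; apply: h.
Qed.

(** On the moment curve [(1, x, x^2, ...)] a nonzero form is a nonzero polynomial in [x], so some
    positive [x] avoids all the zeros. *)
Lemma linear_forms_avoid (T : finType) (L : T -> 'rV[R]_n) : (forall t, L t != 0) ->
  exists d : 'cV[R]_n, forall t, (L t *m d) 0 0 != 0.
Proof.
move=> L0; pose P t := \poly_(i < n) (if insub i is Some j then L t 0 j else 0).
have P0 t : P t != 0.
  apply: contraNneq (L0 t) => Pt; apply/eqP/rowP => j; rewrite mxE.
  by have := coef_poly n (fun i => if insub i is Some j then L t 0 j else 0) j;
    rewrite -/(P t) Pt coef0 ltn_ord valK.
have [x /andP[x0 _] h] := nearp_ex (polys_avoid P0 0) ltr01.
exists (\col_i x ^+ i) => t; have := h (negbT (gt_eqF x0)) t.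
rewrite horner_poly mxE; congr (_ != _); apply: eq_bigr => i _.
by rewrite valK mxE.
Qed.

Lemma cvec_rowE A J l q i : cvec A J l q i 0 = (row i (\adj (cmx A J l)) *m q) 0 0.
Proof. by rewrite -row_mul [RHS]mxE. Qed.

Lemma row_adj_neq0 A J l (u : 'rV[R]_n) : cdet A J l != 0 -> u != 0 ->
  u *m \adj (cmx A J l) != 0.
Proof.
move=> d0 u0; apply: contraNneq u0 => e.
have : u *m \adj (cmx A J l) *m cmx A J l = 0 by rewrite e mul0mx.
by rewrite -mulmxA mul_adj_mx mul_mx_scalar => /eqP; rewrite scaler_eq0 (negPf d0).
Qed.

Lemma delta_row_neq0 i : delta_mx 0 i != 0 :> 'rV[R]_n.
Proof. by apply/eqP => /rowP/(_ i)/eqP; rewrite !mxE !eqxx oner_eq0. Qed.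

Definition line_poly q d : 'cV[{poly R}]_n :=
  map_mx polyC q + 'X *: map_mx polyC d.

Lemma mev_line q d x : mev (line_poly q d) x = q + x *: d.
Proof.
by apply/colP => i; rewrite !mxE /horner_eval !hornerE.
Qed.

Lemma mev_const m k (B : 'M[R]_(m, k)) x : mev (map_mx polyC B) x = B.
Proof. by apply/matrixP => i j; rewrite !mxE /horner_eval hornerC. Qed.

Lemma cvecD A J l q d x i :
  cvec A J l (q + x *: d) i 0 = cvec A J l q i 0 + x * cvec A J l d i 0.
Proof. by rewrite /cvec mulmxDr -scalemxAr !mxE. Qed.

Lemma deg_const_interval (A : 'M[{poly R}]_n) (l : {poly R}) (q : 'cV[{poly R}]_n) x y :
  x <= y -> (forall z, x <= z <= y -> nonsing (mev A z) l.[z] /\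
    generic (mev A z) l.[z] (mev q z)) ->
  deg (mev A x) l.[x] (mev q x) = deg (mev A y) l.[y] (mev q y).
Proof.
move=> xy h; apply: eq_bigr => J _; rewrite !termE /sterm.
rewrite (sgz_noroot xy) => [|z /h[+ _]]; last by move/(_ J); rewrite cdet_ev.
congr (if _ then _ else _); apply: eq_forallb => i.
by rewrite (sgz_noroot xy) => [//|z /h[_ +]]; move/(_ J i); rewrite cvec_ev.
Qed.

Lemma roots_seq (T : finType) (P : T -> {poly R}) : (forall t, P t != 0) ->
  exists2 s : seq R, uniq s & forall x, x \notin s <-> forall t, (P t).[x] != 0.
Proof.
move=> P0; have : \prod_t P t != 0 by apply/prodf_neq0 => t _; apply: P0.
move=> /poly_split [s [h [e hr]]]; exists (undup s); first exact: undup_uniq.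
move=> x; rewrite mem_undup -root_prod_XsubC.
have -> : root (\prod_(a <- s) ('X - a%:P)) x = root (\prod_t P t) x.
  by rewrite e rootM (negPf (hr x)).
rewrite /root horner_prod; split => [/prodf_neq0 k t|k]; first exact: k.
by apply/prodf_neq0 => t _; apply: k.
Qed.

(** On a segment of right-hand sides the degree can only change where an entry of some solution
    vanishes. If no other entry of that solution vanishes there, [deg_cross] shows that the jump is
    zero. *)
Lemma deg_indep A l q0 q1 : nonsing A l -> generic A l q0 -> generic A l q1 ->
  deg A l q0 = deg A l q1.
Proof.
move=> d0 g0 g1.
pose T := ({set 'I_n} * {ij : 'I_n * 'I_n | ij.1 != ij.2})%type.
(* [L] sends [q] to the determinant of order two formed by the entries [i] and [j] of the solutions
   for [q0] and [q]. If it is nonzero at the far end of the segment, these entries never vanish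
   together on the way. *)
pose L (t : T) : 'rV[R]_n := let: (J, ij) := t in
  (cvec A J l q0 (sval ij).1 0 *: delta_mx 0 (sval ij).2 -
   cvec A J l q0 (sval ij).2 0 *: delta_mx 0 (sval ij).1) *m \adj (cmx A J l).
have LE (t : T) q : (L t *m q) 0 0 =
    cvec A t.1 l q0 (sval t.2).1 0 * cvec A t.1 l q (sval t.2).2 0 -
    cvec A t.1 l q0 (sval t.2).2 0 * cvec A t.1 l q (sval t.2).1 0.
  case: t => J [[i j] ij] /=; rewrite /L /= -mulmxA mulmxBl -!scalemxAl.
  by rewrite -!rowE !mxE.
have L0 t : L t != 0.
  case: t => J [[i j] /= ij]; apply: row_adj_neq0 => //=.
  have := g0 J i; move: (cvec A J l q0 i 0) (cvec A J l q0 j 0) => u v u0.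
  apply/eqP => /rowP/(_ j)/eqP; rewrite !mxE !eqxx (eq_sym j) (negPf ij) /=.
  by rewrite mulr0 subr0 mulr1 (negPf u0).
(* [q1] is moved slightly, so that no two coordinates of a solution vanish simultaneously
   on the segment joining [q0] to it. *)
have [d hd] := linear_forms_avoid L0.
pose P (t : T) : {poly R} := ((L t *m q1) 0 0)%:P + ((L t *m d) 0 0) *: 'X.
have P0 t : P t != 0.
  apply/eqP => /polyP/(_ 1%N)/eqP; rewrite !coefE/= add0r mulr1.
  by rewrite (negPf (hd t)).
have N1 := polys_avoid P0 0.
have := @near_deg R n (map_mx polyC A) l%:P (line_poly q1 d) 0.
rewrite !mev_const mev_line hornerC scale0r addr0 => /(_ d0 g1) N2.
have [x /andP[x0 _]] := nearp_ex (nearp_and N1 N2) ltr01.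
rewrite mev_const mev_line hornerC => -[/(_ (negbT (gt_eqF x0))) hP [_ g2 <-]].
set q2 := q1 + x *: d in g2 *.
have F J i j : i != j -> cvec A J l q0 i 0 * cvec A J l q2 j 0 -
    cvec A J l q0 j 0 * cvec A J l q2 i 0 != 0.
  move=> ij; have := hP (J, exist _ (i, j) ij).
  rewrite /P !hornerE -/(L _) -[_ * x]mulrC.
  have -> : (L (J, exist _ (i, j) ij) *m q1) 0 0 + x * (L (J, exist _ (i, j) ij) *m d) 0 0 =
    (L (J, exist _ (i, j) ij) *m q2) 0 0 by rewrite /q2 mulmxDr -scalemxAr !mxE.
  by rewrite LE.
pose q := line_poly q0 (q2 - q0); pose A' := map_mx polyC A.
have cdetE J s : (cdet A' J l%:P).[s] = cdet A J l.
  by rewrite -cdet_ev mev_const hornerC.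
have cvecE J i s : (cvec A' J l%:P q i 0).[s] =
    (1 - s) * cvec A J l q0 i 0 + s * cvec A J l q2 i 0.
  rewrite -cvec_ev mev_const hornerC mev_line.
  have -> : q0 + s *: (q2 - q0) = (1 - s) *: q0 + s *: q2.
    by apply/colP => k; rewrite !mxE; ring.
  have -> : cvec A J l ((1 - s) *: q0 + s *: q2) i 0 =
      (1 - s) * cvec A J l q0 i 0 + s * cvec A J l q2 i 0.
    by rewrite cvecD /cvec -scalemxAr !mxE.
  by [].
have Z0 (t : {set 'I_n} * 'I_n) : cvec A' t.1 l%:P q t.2 0 != 0.
  apply/eqP => /(congr1 (horner^~ 0))/eqP.
  by rewrite cvecE horner0 subr0 mul1r mul0r addr0 (negPf (g0 _ _)).
have [s us hs] := roots_seq Z0.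
have := @jump_sum R s (fun x => deg A l (mev q x)) (fun=> 0) us.
have -> : deg A l q0 = deg A l (mev q 0) by rewrite mev_line scale0r addr0.
have -> : deg A l q2 = deg A l (mev q 1) by rewrite mev_line scale1r addrC subrK.
move=> H; apply/esym/eqP; rewrite -subr_eq0; apply/eqP; rewrite H ?big1//.
- move=> a _; have [|||c [e e0 hc]] := @deg_cross R n A' l%:P q a.
  + by move=> J; rewrite cdetE.
  + by move=> J i; apply: (Z0 (J, i)).
  + move=> J i j; rewrite !cvecE => hi hj; apply/eqP/negP => /negP ij.
    have := F J i j ij; have s0 : a != 0.
      apply/eqP => s0; move: hi; rewrite s0 subr0 mul1r mul0r addr0 => /eqP.
      by rewrite (negPf (g0 J i)).
    case/eqP; apply: (mulfI s0); rewrite mulr0.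
    move: hi hj; move: (cvec A J l q0 i 0) (cvec A J l q0 j 0).
    move: (cvec A J l q2 i 0) (cvec A J l q2 j 0) => X Y u v hi hj.
    transitivity (u * ((1 - a) * v + a * Y) - v * ((1 - a) * u + a * X)); first by ring.
    by rewrite hi hj !mulr0 subr0.
  exists e => // u v u1 u2 v1 v2.
  have hu : `|u - a| < e by rewrite ltr_norml; lra.
  have hv : `|v - a| < e by rewrite ltr_norml; lra.
  have := hc u hu (negbT (lt_eqF u2)); have := hc v hv (negbT (gt_eqF v1)).
  by rewrite !mev_const !hornerC => -> ->; rewrite subrr.
- move=> u v uv hz; have := @deg_const_interval A' l%:P q u v uv.
  rewrite !mev_const !hornerC => -> // z /hz/hs k; rewrite mev_const hornerC; split=> // J i.
  by have := k (J, i); rewrite -cvec_ev mev_const hornerC.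
- apply/hs => t; rewrite cvecE subr0 mul1r mul0r addr0; exact: g0.
- apply/hs => t; rewrite cvecE subrr mul1r mul0r add0r; exact: g2.
Qed.

Lemma generic_exists A l : nonsing A l -> exists q, generic A l q.
Proof.
move=> d0; pose L (t : {set 'I_n} * 'I_n) := row t.2 (\adj (cmx A t.1 l)).
have [|d hd] := @linear_forms_avoid _ L.
  by move=> [J i]; rewrite /L rowE row_adj_neq0// delta_row_neq0.
by exists d => J i; rewrite cvec_rowE; apply: (hd (J, i)).
Qed.

(** By [deg_indep] the choice of [q] is immaterial. The default 0 of [xget] is returned only when no
    generic [q] exists, which [generic_exists] excludes at nonsingular [l]. *)
Definition dg A l : int := deg A l (xget 0 (fun q => generic A l q)).

Lemma dgE A l q : nonsing A l -> generic A l q -> dg A l = deg A l q.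
Proof.
move=> d0 g; apply: deg_indep => //; have [q' g'] := generic_exists d0.
by apply: (@xgetPex _ 0 (fun q => generic A l q)); exists q'.
Qed.

End Independence.

(** * Characteristic polynomials *)


Section Monic.
Variable R : rcfType.
Implicit Types (p h : {poly R}).

Lemma monic_ge1 p : p \is monic -> exists B, forall x, B <= x -> 1 <= p.[x].
Proof.
elim/poly_ind: p => [|p c IH]; first by rewrite monicE lead_coef0 eq_sym oner_eq0.
have [->|p0] := eqVneq p 0.
  rewrite mul0r add0r monicE lead_coefC => /eqP ->.
  by exists 0 => x _; rewrite hornerC.
have lc : lead_coef (p * 'X + c%:P) = lead_coef p.
  by rewrite lead_coefDl ?lead_coefMX// size_mulX// size_polyC; case: eqP => //=; rewrite ltnS lt0n size_poly_eq0.
rewrite monicE lc -monicE => /IH [B hB].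
exists (Num.max B (1 + `|c|)) => x; rewrite ge_max => /andP[/hB h1 h2].
rewrite !hornerE; have := ler_norm (- c); rewrite normrN => h3.
have : p.[x] * x >= 1 * x by rewrite ler_wpM2r//; have := normr_ge0 c; lra.
lra.
Qed.

(** A rootless polynomial keeps the sign that it has near plus infinity. Were its degree odd,
    [- h(-x)] would be monic as well, hence positive somewhere. *)
Lemma monic_noroot h : h \is monic -> (forall x, ~~ root h x) -> 
  (forall x, 0 < h.[x]) /\ ~~ odd (size h).-1.
Proof.
move=> hm nr; have [B hB] := monic_ge1 hm.
have pos x : 0 < h.[x].
  rewrite -sgz_gt0; pose y := Num.max B x.
  have -> : sgz h.[x] = sgz h.[y].
    by apply: sgz_noroot => [|z _]; [rewrite le_max lexx orbT|apply: nr].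
  by rewrite sgz_gt0 (lt_le_trans ltr01)// hB// le_max lexx.
split => //; apply/negP => od.
pose k := - (h \Po (- 'X)); have km : k \is monic.
  rewrite monicE /k lead_coefN lead_coef_comp ?size_polyN ?size_polyX//.
  rewrite lead_coefN lead_coefX (monicP hm) mul1r.
  by rewrite -signr_odd od expr1 opprK.
have [C hC] := monic_ge1 km; have := hC C (lexx _).
rewrite /k hornerN horner_comp => h1; have := pos ((- 'X).[C]); lra.
Qed.

Lemma monic_split p : p \is monic -> exists (s : seq R) (h : {poly R}),
  [/\ p = h * \prod_(a <- s) ('X - a%:P), (forall x, 0 < h.[x]), h \is monic,
   (size s <= (size p).-1)%N & odd (size s) = odd (size p).-1].
Proof.
move=> pm; have [s [h [e nr]]] := poly_split (monic_neq0 pm).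
have hm : h \is monic by move: pm; rewrite e monicMr ?monic_prod_XsubC.
have [h0 ho] := monic_noroot hm nr.
have sz : (size p).-1 = (size s + (size h).-1)%N.
  rewrite e size_Mmonic ?monic_neq0 ?monic_prod_XsubC// size_prod_XsubC.
  have : (0 < size h)%N by rewrite lt0n size_poly_eq0 monic_neq0.
  by case: (size h) => // k _; rewrite addnS /= addnC.
exists s, h; split => //; rewrite sz ?leq_addr// oddD (negPf ho) addbF //.
Qed.

Lemma sgz_prod_XsubC (s : seq R) x : x \notin s ->
  sgz (\prod_(a <- s) ('X - a%:P)).[x] = (-1) ^+ count (fun a => x < a) s.
Proof.
elim: s => [|a s IH]; first by rewrite big_nil hornerC sgz1.
rewrite inE negb_or => /andP[xa xs]; rewrite big_cons hornerM sgzM IH// hornerXsubC /=.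
case: (ltgtP x a) xa => // h _.
  by rewrite ltr0_sgz ?subr_lt0// exprD expr1 mulN1r.
by rewrite gtr0_sgz ?subr_gt0// mul1r add0n.
Qed.

Lemma sgz_monic_split p s h x : p = h * \prod_(a <- s) ('X - a%:P) ->
  (forall x, 0 < h.[x]) -> odd (size s) = odd (size p).-1 -> x \notin s ->
  (-1) ^+ (size p).-1 * sgz p.[x] = (-1) ^+ count (fun a => a < x) s.
Proof.
move=> e h0 o xs; rewrite -signr_odd -o signr_odd e hornerM sgzM gtr0_sgz// mul1r.
rewrite sgz_prod_XsubC//.
have -> : size s = (count (fun a => (a < x)%R) s + count (fun a => (x < a)%R) s)%N.
  rewrite -count_predUI [count (predI _ _) s](_ : _ = 0%N).
    rewrite addn0 -(count_predT s); apply: eq_in_count => a ias /=.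
    by case: ltgtP => // xa; move: xs; rewrite -xa ias.
  apply/eqP; rewrite -leqn0 leqNgt -has_count; apply/negP => /hasP[a _ /=]. 
  by case: ltgtP.
by rewrite exprD -mulrA -expr2 sqrr_sign mulr1.
Qed.

End Monic.

Section CharPoly.
Variables (R : comNzRingType) (n : nat).

Definition pcdet (A : 'M[R]_n) (J : {set 'I_n}) : {poly R} := cdet (map_mx polyC A) J 'X.

(** Multiplying the columns outside [J] by ['X] turns [cmx] into the characteristic matrix of [A]
    with these columns erased. The degree of [pcdet] and its monicity follow from those of
    [char_poly]. *)
Lemma char_poly_pcdet (A : 'M[R]_n) (J : {set 'I_n}) :
  char_poly (\matrix_(i, j) (if j \in J then A i j else 0)) = pcdet A J * 'X^(n - #|J|).
Proof.
pose d : 'rV[{poly R}]_n := \row_j (if j \in J then 1 else 'X).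
have -> : 'X^(n - #|J|) = \det (diag_mx d).
  rewrite det_diag (eq_bigr (fun j => if j \in J then 1 else 'X)) => [|j _]; last by rewrite mxE.
  rewrite (bigID (mem J)) /= [X in X * _]big1 ?mul1r => [|j ->//].
  rewrite (eq_bigr (fun=> 'X)) => [|j /negPf -> //]; rewrite prodr_const.
  by congr ('X^ _); have := cardC (mem J); rewrite card_ord => e; apply/eqP; rewrite -(eqn_add2l #|J|) subnKC; [apply/eqP; symmetry; exact: e|by rewrite -[X in (_ <= X)%N](card_ord n) max_card].
rewrite /pcdet /cdet -det_mulmx; congr (\det _).
apply/matrixP => i j; rewrite mul_mx_diag !mxE; case: ifP => _; rewrite ?mulr1//.
by rewrite polyC0 subr0 mulrC mulr_natr.
Qed.

Lemma pcdet_monic (A : 'M[R]_n) (J : {set 'I_n}) : pcdet A J \is monic /\ (size (pcdet A J)).-1 = #|J|.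
Proof.
have := char_poly_monic (\matrix_(i, j) (if j \in J then A i j else 0)).
have := size_char_poly (\matrix_(i, j) (if j \in J then A i j else 0)).
rewrite char_poly_pcdet => sz.
rewrite monicMr ?monicXn// => pm; split=> //; move: sz.
rewrite size_Mmonic ?monic_neq0 ?monicXn// size_polyXn.
have : (#|J| <= n)%N by rewrite -[X in (_ <= X)%N](card_ord n) max_card.
rewrite addnS /=; move: (size _) #|_| => u v vn /(congr1 (subn^~ (n - v)%N)).
by rewrite addnK => ->; rewrite subSn ?leq_subr//= subKn.
Qed.

End CharPoly.

(** * The jump of the degree at an eigenvalue *)


Section Local.
Variables (R : rcfType) (n : nat).
Implicit Types (J : {set 'I_n}) (A : 'M[R]_n) (q : 'cV[R]_n) (a x : R).

Lemma pcdetE A J x : (pcdet A J).[x] = cdet A J x.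
Proof. by rewrite /pcdet -cdet_ev mev_const hornerX. Qed.

Definition pcvec A J q i : {poly R} := cvec (map_mx polyC A) J 'X (map_mx polyC q) i 0.

Lemma pcvecE A J q i x : (pcvec A J q i).[x] = cvec A J x q i 0.
Proof. by rewrite /pcvec -cvec_ev !mev_const hornerX. Qed.

Lemma rts_exists A J : exists s : seq R, exists h : {poly R},
  [/\ pcdet A J = h * \prod_(a <- s) ('X - a%:P), (forall x, 0 < h.[x]), h \is monic,
   (size s <= #|J|)%N & odd (size s) = odd #|J|].
Proof.
have [pm sz] := pcdet_monic A J; have [s [h H]] := monic_split pm.
by exists s, h; rewrite sz in H.
Qed.

(* The real eigenvalues of the principal submatrix indexed by [J], with multiplicity. *)
Definition rts A J : seq R := sval (cid (rts_exists A J)).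

Lemma rtsP A J : exists h : {poly R},
  [/\ pcdet A J = h * \prod_(a <- rts A J) ('X - a%:P), (forall x, 0 < h.[x]), h \is monic,
   (size (rts A J) <= #|J|)%N & odd (size (rts A J)) = odd #|J|].
Proof. exact: (svalP (cid (rts_exists A J))). Qed.

Lemma cdet_eq0 A J x : (cdet A J x == 0) = (x \in rts A J).
Proof.
have [h [e h0 _ _ _]] := rtsP A J.
by rewrite -pcdetE e hornerM mulf_eq0 (gt_eqF (h0 x)) -/(root _ x) root_prod_XsubC.
Qed.

Lemma sgz_cdet A J x : x \notin rts A J ->
  (-1) ^+ #|J| * sgz (cdet A J x) = (-1) ^+ count (fun a => a < x) (rts A J).
Proof.
move=> xs; have [h [e h0 _ _ o]] := rtsP A J; have [_ sz] := pcdet_monic A J.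
by rewrite -pcdetE -sz (sgz_monic_split e h0)// sz.
Qed.

Lemma pcdet_mult A J a : exists g : {poly R},
  g.[a] != 0 /\ pcdet A J = ('X - a%:P) ^+ count_mem a (rts A J) * g.
Proof.
have [h [e h0 _ _ _]] := rtsP A J.
exists (h * \prod_(b <- rts A J | b != a) ('X - b%:P)); split.
  rewrite hornerM; apply: mulf_neq0; first by rewrite gt_eqF.
  rewrite horner_prod prodf_seq_neq0; apply/allP => b _; apply/implyP => ba.
  by rewrite hornerXsubC subr_eq0 eq_sym.
rewrite e (bigID (pred1 a)) /= mulrCA; congr (_ * _).
rewrite (eq_bigr (fun=> 'X - a%:P)) => [|b /eqP -> //].
by rewrite big_const_seq iter_mulr_1.
Qed.

(* The number of even positions that the eigenvalue [a] occupies in the increasing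
   enumeration of the real eigenvalues of the principal submatrix indexed by [J]. *)
Definition evens A J a : nat :=
  ((count (fun b => (b <= a)%R) (rts A J))./2 - (count (fun b => (b < a)%R) (rts A J))./2)%N.

Lemma count_le_lt A J a : count (fun b => b <= a) (rts A J) =
  (count (fun b => (b < a)%R) (rts A J) + count_mem a (rts A J))%N.
Proof.
rewrite -count_predUI [count (predI _ _) _](_ : _ = 0%N).
  by rewrite addn0; apply: eq_count => b /=; rewrite le_eqVlt orbC.
apply/eqP; rewrite -leqn0 leqNgt -has_count; apply/negP => /hasP[b _ /=].
by case: ltgtP.
Qed.

Definition touched A J a := exists z : 'cV[R]_n,
  [/\ z != 0, (forall i, 0 <= z i 0) & cmx A J a *m z = 0].

(** A substitute for [generic] at a point [a] where determinants may vanish. The second clause gives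
    every entry a sign on either side of [a]; the third keeps [q] out of the range of each singular
    matrix. *)
Definition good A a q :=
  [/\ forall J i, cdet A J a != 0 -> cvec A J a q i 0 != 0,
      forall J i, pcvec A J q i != 0
    & forall J, cdet A J a = 0 -> exists2 y : 'rV[R]_n, y *m cmx A J a = 0 & (y *m q) 0 0 != 0].

Lemma pcdet_neq0 A J : pcdet A J != 0.
Proof. by have [/monic_neq0] := pcdet_monic A J. Qed.

Lemma near_nonsing A a : nearp a (fun x => x != a -> nonsing A x).
Proof.
apply: nearpW (polys_avoid (pcdet_neq0 A) a) => x h xa J.
by rewrite -pcdetE; apply: h.
Qed.

(** Each clause asks that linear forms in [q] do not vanish; for the polynomials [pcvec] this is
    tested at a nonsingular point [b] near [a]. *)
Lemma good_exists A a : exists d, forall q0,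
  nearp 0 (fun t => t != 0 -> good A a (q0 + t *: d)).
Proof.
have [b /andP[ab _] hb] := nearp_ex (near_nonsing A a) ltr01.
have {}hb := hb (negbT (gt_eqF ab)).
have Ly J i : exists v : 'rV[R]_n, v != 0 /\
    ((cdet A J a != 0 -> v = row i (\adj (cmx A J a))) /\ (cdet A J a = 0 -> v *m cmx A J a = 0)).
  case: (eqVneq (cdet A J a) 0) => [/eqP/det0P[v v0 v1]|d0].
    by exists v; split=> //; split.
  exists (row i (\adj (cmx A J a))); split; last by split => // /eqP; rewrite (negPf d0).
  by rewrite rowE row_adj_neq0// delta_row_neq0.
have [L hL] := choice (fun t : {set 'I_n} * 'I_n => Ly t.1 t.2).
pose F (t : ({set 'I_n} * 'I_n) * bool) := if t.2 then L t.1 else row t.1.2 (\adj (cmx A t.1.1 b)).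
have F0 t : F t != 0.
  rewrite /F; case: ifP => _; first by case: (hL t.1).
  by rewrite rowE row_adj_neq0// delta_row_neq0.
have [d hd] := linear_forms_avoid F0; exists d => q0.
pose P t : {poly R} := ((F t *m q0) 0 0)%:P + ((F t *m d) 0 0) *: 'X.
have P0 t : P t != 0.
  apply/eqP => /polyP/(_ 1%N)/eqP; rewrite !coefE/= add0r mulr1.
  by rewrite (negPf (hd t)).
apply: nearpW (polys_avoid P0 0) => x h /h {}h.
have {}h t : (F t *m (q0 + x *: d)) 0 0 != 0.
  have := h t; rewrite /P hornerD hornerC hornerZ hornerX mulrC.
  by rewrite mulmxDr -scalemxAr [X in _ -> X != 0]mxE [X in _ -> _ + X != 0]mxE.
split=> [J i d0|J i|J d0].
- by have := h ((J, i), true); rewrite cvec_rowE /F /=; have [_ [-> //]] := hL (J, i).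
- apply/eqP => /(congr1 (horner^~ b))/eqP; rewrite pcvecE horner0 cvec_rowE.
  by apply/negP; apply: (h ((J, i), false)).
- have [i _|n0] := pickP (mem 'I_n); last first.
    by move: d0; rewrite /cdet => /eqP/det0P[v v0]; case/negP: v0; apply/eqP/rowP => i; have := n0 i.
  by exists (L (J, i)); [have [_ [_ ->]] := hL (J, i)|apply: (h ((J, i), true))].
Qed.

Lemma vec_factor (Z : 'I_n -> {poly R}) a i0 : Z i0 != 0 ->
  exists (k : nat) (Y : 'I_n -> {poly R}),
    (forall i, Z i = ('X - a%:P) ^+ k * Y i) /\ (exists i, (Y i).[a] != 0).
Proof.
elim: {Z}(size (Z i0)) {-2}Z (leqnn (size (Z i0))) => [|m IH] Z sz Z0.
  by move: sz; rewrite leqn0 size_poly_eq0 (negPf Z0).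
have [h|h] := pselect (exists i, (Z i).[a] != 0).
  by exists 0%N, Z; split => // i; rewrite expr0 mul1r.
have /choice[W hW] : forall i, exists w, Z i = w * ('X - a%:P).
  by move=> i; apply/factor_theorem/rootP/eqP/negP => /negP k; apply: h; exists i.
have W0 : W i0 != 0 by apply: contraNneq Z0 => e; rewrite hW e mul0r.
have [|//|k [Y [hY ex]]] := IH W.
  by move: sz; rewrite hW size_Mmonic ?monicXsubC// size_XsubC addn2.
exists k.+1, Y; split => // i; rewrite hW hY exprS; ring.
Qed.

(** Divide [cmx *m cvec = cdet *: q] by a power of [X - a] and evaluate at [a]. If [k] reached the
    multiplicity of [a], then [q] would lie in the range of the singular matrix, against [good]. So
    [k] is smaller and the right-hand side vanishes at [a]. *)
Lemma touch_core A J a q : good A a q -> cdet A J a = 0 ->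
  exists (k : nat) (Y : 'I_n -> {poly R}),
  [/\ (forall i, pcvec A J q i = ('X - a%:P) ^+ k * Y i), (exists i, (Y i).[a] != 0),
   (k < count_mem a (rts A J))%N & cmx A J a *m (\col_i (Y i).[a]) = 0].
Proof.
move=> [_ g2 g3] d0.
have /eqP/det0P[v v0 _] := d0.
have [i0 _] : exists i, v 0 i != 0.
  apply: contrapT => h; case/negP: v0; apply/eqP/rowP => i; rewrite mxE.
  by apply/eqP/negPn/negP => k; apply: h; exists i.
have [k [Y [hY [i1 Yi1]]]] := vec_factor a (g2 J i0).
have [g [ga gE]] := pcdet_mult A J a.
set m := count_mem a _ in gE *.
pose M := cmx (map_mx polyC A) J 'X; pose y : 'cV_n := \col_i (Y i).
have Zy : cvec (map_mx polyC A) J 'X (map_mx polyC q) = ('X - a%:P) ^+ k *: y.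
  by apply/colP => i; rewrite [RHS]mxE [y i 0]mxE -hY.
have Me := mul_cmx_cvec (map_mx polyC A) J 'X (map_mx polyC q).
rewrite Zy -scalemxAr -/(pcdet A J) gE -scalerA in Me.
have ev (w : 'cV[{poly R}]_n) : mev (M *m w) a = cmx A J a *m mev w a.
  rewrite /mev map_mxM /M cmx_map (mev_const A a : map_mx _ _ = A).
  by congr (cmx _ _ _ *m _); apply: hornerX.
have evZ (p : {poly R}) (w : 'cV[{poly R}]_n) : mev (p *: w) a = p.[a] *: mev w a.
  by rewrite /mev map_mxZ.
have Xk j : ('X - a%:P) ^+ j != 0 :> {poly R} by rewrite expf_neq0// monic_neq0// monicXsubC.
have scI (p : {poly R}) (u w : 'cV[{poly R}]_n) : p != 0 -> p *: u = p *: w -> u = w.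
  move=> p0 e; apply/colP => i; apply: (mulfI p0).
  by have /colP/(_ i) := e; rewrite !mxE.
have km : (k < m)%N.
  rewrite ltnNge; apply/negP => mk.
  move: Me; rewrite -(subnKC mk) exprD -scalerA => /(scI _ _ _ (Xk m)) e.
  have := congr1 (fun w => mev w a) e; rewrite evZ ev evZ mev_const => e2.
  have [u u0 uq] := g3 J d0; case/negP: uq.
  have := congr1 (fun w => (u *m w) 0 0) e2.
  rewrite -scalemxAr mulmxA u0 mul0mx scaler0 mxE -scalemxAr [RHS]mxE => /eqP.
  by rewrite eq_sym mulf_eq0 (negPf ga).
exists k, Y; split => //; first by exists i1.
move: Me; rewrite -(subnKC (ltnW km)) exprD -scalerA => /(scI _ _ _ (Xk k)) e.
have := congr1 (fun w => mev w a) e; rewrite ev !evZ horner_exp hornerXsubC subrr.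
rewrite expr0n subn_eq0 leqNgt km /= scale0r => <-.
by congr (_ *m _); apply/colP => i; rewrite !mxE.
Qed.

(** The kernel vector of [touch_core] is the limiting direction of solutions that are positive
    arbitrarily close to [a], so its entries cannot have opposite signs. *)
Lemma touch_near A J a q : good A a q -> cdet A J a = 0 ->
  (forall P, nearp a P -> exists2 x, P x & x != a /\ forall i, 0 < cdet A J x * cvec A J x q i 0) ->
  touched A J a.
Proof.
move=> gq d0 freq; have [k [Y [hY [i Yi] _ Y0]]] := touch_core gq d0.
have same u v : 0 < (Y u).[a] -> (Y v).[a] < 0 -> False.
  move=> pu pv.
  have [x [hu hv] [xa hx]] := freq _ (nearp_and (nearp_sgz (negbT (gt_eqF pu))) (nearp_sgz (negbT (lt_eqF pv)))).
  have {}hu : 0 < (Y u).[x] by rewrite -sgz_gt0 hu sgz_gt0.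
  have {}hv : (Y v).[x] < 0 by rewrite -sgz_lt0 hv sgz_lt0.
  have := hx u; have := hx v; rewrite -!pcvecE !hY !hornerM.
  move: (cdet A J x) (('X - a%:P)^+k).[x] => s t h1 h2.
  have : 0 < s * t by rewrite -(pmulr_lgt0 _ hu) -mulrA.
  by move=> h; move: h1; rewrite mulrA pmulr_rgt0// ltNge ltW.
have z0 : \col_i (Y i).[a] != 0 by apply: contraNneq Yi => /colP/(_ i); rewrite !mxE => ->.
have [h|h] := pselect (forall i, 0 <= (Y i).[a]).
  by exists (\col_i (Y i).[a]); split => // j; rewrite mxE.
exists (- \col_i (Y i).[a]); split; rewrite ?oppr_eq0// ?mulmxN ?Y0 ?oppr0//.
move=> j; rewrite !mxE oppr_ge0 leNgt; apply/negP => pj; apply: h => u.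
by rewrite leNgt; apply/negP => /(same _ _ pj).
Qed.

Lemma poly_sides (p : {poly R}) a : p != 0 -> exists sL sR,
  nearp a (fun x => (x < a -> sgz p.[x] = sL) /\ (a < x -> sgz p.[x] = sR)).
Proof.
move=> /(poly_isolated a) [e e0 he].
exists (sgz p.[a - e / 2]), (sgz p.[a + e / 2]), e => // x; rewrite ltr_norml => xe.
have nr z : - e < z - a < e -> z != a -> p.[z] != 0 by move=> ze; apply: he; rewrite ltr_norml.
have key u v : u <= v -> - e < u - a -> v - a < e -> (v < a \/ a < u) -> sgz p.[u] = sgz p.[v].
  move=> uv h1 h2 h3; apply: sgz_noroot => // z zuv; apply: nr; first by lra.
  by case: h3 => h3; [rewrite lt_eqF|rewrite gt_eqF]; lra.
split => h.
  case: (leP x (a - e / 2)) => h'; [apply: key|symmetry; apply: key]; lra.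
case: (leP x (a + e / 2)) => h'; [apply: key|symmetry; apply: key]; lra.
Qed.

End Local.


(** * One-sided values of the terms at an eigenvalue *)

Section Jump.
Variables (R : rcfType) (n : nat).
Implicit Types (J : {set 'I_n}) (A : 'M[R]_n) (q : 'cV[R]_n) (a x : R).

Lemma near_count (s : seq R) a : nearp a (fun x =>
  [/\ x != a -> x \notin s,
      x < a -> count (fun b => b < x) s = count (fun b => b < a) s
    & a < x -> count (fun b => b < x) s = count (fun b => b <= a) s]).
Proof.
have [e e0 he] := seq_isolated s a; exists e => // x; rewrite ltr_norml => xe.
have far b : b \in s -> b != a -> b <= a - e \/ a + e <= b.
  move=> bs ba; have := he b bs ba; rewrite ler_normr => /orP[]h; [right|left]; lra.
split=> [xa|xa|xa].
- by apply/negP => xs; have [] := far x xs xa; lra.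
- apply: eq_in_count => b bs /=; case: (eqVneq b a) => [->|ba].
    by rewrite ltxx; apply/negbTE; rewrite -leNgt ltW.
  have [h|h] := far b bs ba; first by transitivity true; [|symmetry]; lra.
  by transitivity false; [|symmetry]; apply/negbTE; rewrite -leNgt; lra.
- apply: eq_in_count => b bs /=; case: (eqVneq b a) => [->|ba]; first by rewrite xa lexx.
  have [h|h] := far b bs ba; first by transitivity true; [|symmetry]; lra.
  by transitivity false; [|symmetry]; apply/negbTE; rewrite -?ltNge -?leNgt; lra.
Qed.

Definition sided A a q (tL tR : {set 'I_n} -> int) :=
  nearp a (fun x => forall J, (x < a -> term A x q J = tL J) /\ (a < x -> term A x q J = tR J)).

Lemma sided_exists A a q : good A a q -> exists tL tR, sided A a q tL tR.
Proof.
move=> [_ g2 _].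
have /choice[t ht] : forall J, exists t : int * int, nearp a (fun x =>
    (x < a -> term A x q J = t.1) /\ (a < x -> term A x q J = t.2)).
  move=> J; have [dL [dR hd]] := poly_sides a (pcdet_neq0 A J).
  have /choice[z hz] : forall i, exists z : int * int, nearp a (fun x =>
      (x < a -> sgz (pcvec A J q i).[x] = z.1) /\ (a < x -> sgz (pcvec A J q i).[x] = z.2)).
    by move=> i; have [zL [zR h]] := poly_sides a (g2 J i); exists (zL, zR).
  exists (if [forall i, 0 < dL * (z i).1] then (-1) ^+ #|J| * dL else 0,
          if [forall i, 0 < dR * (z i).2] then (-1) ^+ #|J| * dR else 0).
  apply: nearpW (nearp_and hd (nearp_all hz)) => x [[d1 d2] h]; rewrite /term /sterm -pcdetE.
  split => xa /=.
    by rewrite d1//; congr (if _ then _ else _); apply: eq_forallb => i;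
      rewrite -pcvecE (h i).1.
  by rewrite d2//; congr (if _ then _ else _); apply: eq_forallb => i;
    rewrite -pcvecE (h i).2.
by exists (fun J => (t J).1), (fun J => (t J).2); apply: nearp_all ht.
Qed.

Lemma has_jump_sided A a q tL tR : good A a q -> sided A a q tL tR ->
  has_jump (dg A) a (\sum_J (tR J - tL J)).
Proof.
move=> [_ g2 _] st.
have gen := polys_avoid (fun t : {set 'I_n} * 'I_n => g2 t.1 t.2) a.
have [e e0 he] := nearp_and st (nearp_and gen (near_nonsing A a)).
have dE x : `|x - a| < e -> x != a -> dg A x = \sum_J term A x q J.
  move=> /he [_ [h1 h2]] xa; apply: dgE; first exact: h2.
  by move=> J i; rewrite -pcvecE; apply: (h1 xa (J, i)).
exists e => // x y x1 x2 y1 y2.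
have xe : `|x - a| < e by rewrite ltr_norml; lra.
have ye : `|y - a| < e by rewrite ltr_norml; lra.
rewrite dE// ?(gt_eqF y1)// dE// ?(lt_eqF x2)// sumrB.
by congr (_ - _); apply: eq_bigr => J _; [rewrite ((he y ye).1 J).2|rewrite ((he x xe).1 J).1].
Qed.

Lemma has_jump_uniq (g : R -> int) a d d' : has_jump g a d -> has_jump g a d' -> d = d'.
Proof.
move=> [e e0 he] [f f0 hf].
have : 0 < Num.min e f <= e by rewrite lt_min e0 f0 ge_min lexx.
have : 0 < Num.min e f <= f by rewrite lt_min e0 f0 ge_min lexx orbT.
move: (Num.min e f) => m mf me.
by rewrite -(he (a - m / 2) (a + m / 2)); try lra; rewrite -(hf (a - m / 2) (a + m / 2)); lra.
Qed.

Lemma term_pos A x q J : term A x q J != 0 -> forall i, 0 < cdet A J x * cvec A J x q i 0.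
Proof.
by rewrite /term /sterm; case: ifP => [/forallP h _ i|_]; rewrite ?eqxx// -sgz_gt0 sgzM h.
Qed.

Lemma nearp_left a (P : R -> Prop) : nearp a P -> exists2 x, x < a & P x.
Proof.
move=> [e e0 h]; exists (a - e / 2); first lra.
by apply: h; rewrite ltr_norml; lra.
Qed.

Lemma nearp_right a (P : R -> Prop) : nearp a P -> exists2 x, a < x & P x.
Proof.
move=> [e e0 h]; exists (a + e / 2); first lra.
by apply: h; rewrite ltr_norml; lra.
Qed.

(** Here [r] counts the eigenvalues below [a] and [m] is the multiplicity of [a]; the bound counts
    the even integers in [(r, r + m]]. A rise by 2 needs [r] odd and [r + m] even, and [m = 1] is
    excluded, so [r + 1] and [r + m] are two even integers. *)
Lemma parity_bound (r m : nat) (tl tr : int) : (0 < m)%N ->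
  (m = 1%N -> tl = 0 \/ tr = 0) ->
  (tl = 0 \/ tl = (-1) ^+ r) -> (tr = 0 \/ tr = (-1) ^+ (r + m)) ->
  tr - tl <= ((r + m)./2 - r./2)%N%:Z.
Proof.
move=> m0; rewrite -signr_odd -[(-1) ^+ (r + m)]signr_odd oddD.
have := odd_double_half r; have := odd_double_half (r + m); rewrite oddD.
move: (r./2) ((r + m)./2) => u v; rewrite -!muln2.
by case: (odd r); case: (odd m); rewrite ?expr0 ?expr1/= => e1 e2 h1 [] hl [] hr; have [/h1[]|m1] := eqVneq m 1%N; move: hl hr; lia.
Qed.

(** Without even integer in [(r, r + m]], [r] is even and [m = 1]; the term may then be 1 on the
    left or -1 on the right, but not both. *)
Lemma parity_strict (r m : nat) (tl tr : int) : (0 < m)%N ->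
  ((r + m)./2 - r./2)%N = 0%N -> tr != 0 ->
  (m = 1%N -> tl = 0 \/ tr = 0) ->
  (tl = 0 \/ tl = (-1) ^+ r) -> (tr = 0 \/ tr = (-1) ^+ (r + m)) -> tr - tl = -1.
Proof.
move=> m0; rewrite -signr_odd -[(-1) ^+ (r + m)]signr_odd oddD.
have := odd_double_half r; have := odd_double_half (r + m); rewrite oddD.
move: (r./2) ((r + m)./2) => u v; rewrite -!muln2.
by case: (odd r); case: (odd m); rewrite ?expr0 ?expr1/= => e1 e2 h0 h1 h2 [] hl [] hr; have [/h2[]|m1] := eqVneq m 1%N; move: hl hr; lia.
Qed.

Section Bounds.
Variables (A : 'M[R]_n) (a : R) (q : 'cV[R]_n) (tL tR : {set 'I_n} -> int).
Hypotheses (gq : good A a q) (st : sided A a q tL tR).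

Lemma sided_nonsing J : cdet A J a != 0 -> tL J = tR J.
Proof.
move=> d0; have [g1 g2 _] := gq.
have H : nearp a (fun x => term A x q J = term A a q J).
  have := @sterm_near R n (pcdet A J) (pcvec A J q) a J.
  rewrite pcdetE => /(_ d0) [i|]; first by rewrite pcvecE g1.
  move=> e e0 he; exists e => // x /he; rewrite /term /sterm !pcdetE.
  have E y : [forall i, 0 < sgz (cdet A J y) * sgz (pcvec A J q i).[y]] =
      [forall i, 0 < sgz (cdet A J y) * sgz (cvec A J y q i 0)].
    by apply: eq_forallb => i; rewrite pcvecE.
  by rewrite !E.
have [x xa [h1 h2]] := nearp_left (nearp_and st H).
have [y ya [h3 h4]] := nearp_right (nearp_and st H).
by rewrite -(h1 J).1// -(h3 J).2// h2 h4.
Qed.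

Lemma sided_touched J : cdet A J a = 0 -> tL J != 0 \/ tR J != 0 -> touched A J a.
Proof.
move=> d0 h; apply: (touch_near gq d0) => P nP; case: h => h.
  have [x xa [h1 h2]] := nearp_left (nearp_and st nP).
  exists x => //; split; first by rewrite lt_eqF.
  by apply: term_pos; rewrite (h1 J).1.
have [x xa [h1 h2]] := nearp_right (nearp_and st nP).
exists x => //; split; first by rewrite gt_eqF.
by apply: term_pos; rewrite (h1 J).2.
Qed.

(** At a simple eigenvalue the exponent [k] of [touch_core] is 0, so some entry of [cvec] keeps its
    sign near [a] while the determinant changes sign. *)
Lemma sided_simple J : cdet A J a = 0 -> count_mem a (rts A J) = 1%N ->
  tL J = 0 \/ tR J = 0.
Proof.
move=> d0 m1; apply: contrapT => /not_orP[/eqP hL /eqP hR].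
have [k [Y [hY [i Yi] + _]]] := touch_core gq d0; rewrite m1 ltnS leqn0 => /eqP k0.
have [g [ga gE]] := pcdet_mult A J a; rewrite m1 expr1 in gE.
have zE x : cvec A J x q i 0 = (Y i).[x] by rewrite -pcvecE hY k0 expr0 mul1r.
have dE x : cdet A J x = (x - a) * g.[x] by rewrite -pcdetE gE hornerM hornerXsubC.
have ngY : (g * Y i).[a] != 0 by rewrite hornerM mulf_neq0.
have [x xa [h1 h2]] := nearp_left (nearp_and st (nearp_sgz ngY)).
have [y ya [h3 h4]] := nearp_right (nearp_and st (nearp_sgz ngY)).
have := @term_pos A x q J; rewrite (h1 J).1// => /(_ hL i).
have := @term_pos A y q J; rewrite (h3 J).2// => /(_ hR i).
rewrite !zE !dE -!mulrA -!hornerM; rewrite pmulr_rgt0 ?subr_gt0// nmulr_rgt0 ?subr_lt0//.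
by rewrite -sgz_gt0 -sgz_lt0 h2 h4 sgz_gt0 sgz_lt0 => h5 h6; lra.
Qed.

Lemma sided_val J :
  (tL J = 0 \/ tL J = (-1) ^+ count (fun b => b < a) (rts A J)) /\
  (tR J = 0 \/ tR J = (-1) ^+ count (fun b => b <= a) (rts A J)).
Proof.
have val x : x \notin rts A J ->
    term A x q J = 0 \/ term A x q J = (-1) ^+ count (fun b => b < x) (rts A J).
  by move=> /sgz_cdet <-; rewrite /term /sterm; case: ifP; [right|left].
split.
  have [x xa [h1 [h2 h3 _]]] := nearp_left (nearp_and st (near_count (rts A J) a)).
  by rewrite -h3// -(h1 J).1//; apply: val; apply: h2; rewrite lt_eqF.
have [x xa [h1 [h2 _ h3]]] := nearp_right (nearp_and st (near_count (rts A J) a)).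
by rewrite -h3// -(h1 J).2//; apply: val; apply: h2; rewrite gt_eqF.
Qed.

Lemma sided_bound J : tR J - tL J <= (evens A J a)%:Z.
Proof.
have [d0|d0] := eqVneq (cdet A J a) 0; last by rewrite sided_nonsing// subrr.
have [hL hR] := sided_val J; rewrite count_le_lt in hR; rewrite /evens count_le_lt.
apply: parity_bound hL hR; last exact: sided_simple.
by rewrite -has_count has_pred1 -cdet_eq0 d0 eqxx.
Qed.

Lemma sided_strict J : cdet A J a = 0 -> evens A J a = 0%N -> tR J != 0 -> tR J - tL J = -1.
Proof.
move=> d0 ev h.
have [hL hR] := sided_val J; rewrite count_le_lt in hR; rewrite /evens count_le_lt in ev.
apply: (parity_strict _ ev h _ hL hR); last exact: sided_simple.
by rewrite -has_count has_pred1 -cdet_eq0 d0 eqxx.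
Qed.

End Bounds.
End Jump.


(** * Adapted right-hand sides and the bound on the jump *)

Section Special.
Variables (R : rcfType) (n : nat).
Implicit Types (J : {set 'I_n}) (A : 'M[R]_n) (q : 'cV[R]_n) (a x : R).

Lemma poly_ext (p q : {poly R}) : (forall x, p.[x] = q.[x]) -> p = q.
Proof.
move=> h; apply/eqP; rewrite -subr_eq0; apply/negPn/negP => d0.
have [x x0 /(_ (negbT (gt_eqF x0)))/eqP] := nearp_right (nearp_neq0 0 d0); apply.
by rewrite hornerD hornerN h subrr.
Qed.

Lemma det_replace_col (M : 'M[R]_n) q i :
  \det (\matrix_(r, c) (if c == i then q r 0 else M r c)) = (\adj M *m q) i 0.
Proof.
rewrite (expand_det_col _ i) mxE; apply: eq_bigr => k _; rewrite !mxE eqxx mulrC.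
congr (_ * _); rewrite /cofactor; congr (_ * \det _).
by apply/matrixP => r c; rewrite !mxE eq_sym (negPf (neq_lift _ _)).
Qed.

(** Replacing column [i] of [M] by [q] gives a matrix with determinant [c * z i 0], invertible when
    [z i 0 != 0]. It acts as [M] on the vectors with zero [i]-th entry. *)
Lemma kernel_line (M : 'M[R]_n) (z q : 'cV[R]_n) (c : R) : z != 0 -> M *m z = 0 ->
  c != 0 -> \adj M *m q = c *: z -> forall v : 'cV[R]_n, M *m v = 0 -> exists c', v = c' *: z.
Proof.
move=> z0 Mz c0 adj v Mv.
have [i zi] := cV_neq0_ex z0.
exists (v i 0 / z i 0); set c' := _ / _.
pose v' := v - c' *: z; pose M' := \matrix_(r, k) (if k == i then q r 0 else M r k).
have v'i : v' i 0 = 0 by rewrite /v' !mxE /c' divfK// subrr.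
have M'u : M' \in unitmx.
  by rewrite unitmxE det_replace_col adj mxE unitfE mulf_neq0.
have : M' *m v' = 0.
  have -> : M' *m v' = M *m v'.
    apply/colP => r; rewrite !mxE; apply: eq_bigr => k _; rewrite !mxE.
    case: eqVneq => [->|//]; move: v'i; rewrite /v' !mxE => ->; rewrite !mulr0 //.
  by rewrite /v' mulmxBr Mv -scalemxAr Mz scaler0 subrr.
move=> /(congr1 (mulmx (invmx M'))); rewrite mulKmx// mulmx0 => /eqP.
by rewrite subr_eq0 => /eqP.
Qed.

(** With [e] the indicator of the zeros of [z], the matrix [cmx A J x] sends [z + (x - a) e] to
    [(x - a) q0]. So [q0] has the solution [z / (x - a) + e], positive to the right of [a]; a small
    multiple of [d] is then added to make it [good]. *)
Lemma special_q A J a (z : 'cV[R]_n) : z != 0 -> (forall i, 0 <= z i 0) ->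
  (forall i, i \in J -> 0 < z i 0) -> cmx A J a *m z = 0 -> count_mem a (rts A J) = 1%N ->
  exists2 q, good A a q & nearp a (fun x => a < x -> forall i, 0 < cdet A J x * cvec A J x q i 0).
Proof.
move=> z0 zp zJ Mz m1.
have [g [ga gE]] := pcdet_mult A J a; rewrite m1 expr1 in gE.
pose e : 'cV[R]_n := \col_i (z i 0 == 0)%:R.
pose q0 : 'cV[R]_n := \col_i (if i \in J then z i 0 else 0) + e.
have eJ k : k \in J -> e k 0 = 0 by move=> kJ; rewrite mxE gt_eqF// zJ.
have Mz' x : cmx A J x *m z = (x - a) *: \col_i (if i \in J then z i 0 else 0).
  apply/colP => r; have /colP/(_ r) := Mz; rewrite !cmx_mulE mxE => /eqP.
  by rewrite subr_eq0 => /eqP <-; rewrite !mxE; case: ifP => _; ring.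
have Me' x : cmx A J x *m e = e.
  apply/colP => r; rewrite cmx_mulE big1 ?subr0 => [|k kJ]; last by rewrite eJ// mulr0.
  by case: ifP => // rJ; rewrite eJ// mulr0.
have Me x : cmx A J x *m (z + (x - a) *: e) = (x - a) *: q0.
  by rewrite mulmxDr -scalemxAr Mz' Me' scalerDr.
have q0E i : pcvec A J q0 i = g * ((z i 0)%:P + (e i 0) *: ('X - a%:P)).
  have X0 : 'X - a%:P != 0 :> {poly R} by rewrite monic_neq0// monicXsubC.
  apply: (mulfI X0); apply: poly_ext => x.
  have /colP/(_ i) := cvec_mul_cmx A J x (z + (x - a) *: e).
  rewrite Me /cvec -scalemxAr -/(cvec A J x q0).
  have sE (c : R) (u : 'cV[R]_n) : (c *: u) i 0 = c * u i 0 by rewrite mxE.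
  have aE (u v : 'cV[R]_n) : (u + v) i 0 = u i 0 + v i 0 by rewrite mxE.
  rewrite !sE aE sE -pcvecE -pcdetE gE !hornerE => ->.
  by rewrite [e i 0 * _]mulrC.
have [d hd] := good_exists A a.
have adjz : \adj (cmx A J a) *m q0 = g.[a] *: z.
  apply/colP => i; rewrite -/(cvec A J a q0) -pcvecE q0E [RHS]mxE !hornerE.
  by rewrite subrr mulr0 addr0.
have d0 : cdet A J a = 0.
  by apply/eqP; rewrite cdet_eq0 -has_pred1 has_count m1.
(* The kernel at [a] is the line of [z], so where [z] vanishes the contribution of [d] is divisible
   by [X - a], as is that of [q0]. After division, a small [t] preserves the sign. *)
have [c hc] : exists c, cvec A J a d = c *: z.
  apply: (kernel_line z0 Mz ga adjz).
  by rewrite mul_cmx_cvec d0 scale0r.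
have /choice[UW hUW] : forall i, exists UW : nat * ({poly R} * {poly R}),
    [/\ pcvec A J q0 i = ('X - a%:P) ^+ UW.1 * UW.2.1, pcvec A J d i = ('X - a%:P) ^+ UW.1 * UW.2.2
      & 0 < g.[a] * UW.2.1.[a]].
  have g2 : 0 < g.[a] ^+ 2 by rewrite exprn_even_gt0.
  move=> i; have [zi|zi] := eqVneq (z i 0) 0; last first.
    exists (0%N, (pcvec A J q0 i, pcvec A J d i)); rewrite /= !expr0 !mul1r; split=> //.
    rewrite pcvecE /cvec adjz mxE mulrA -expr2 mulr_gt0//.
    by rewrite lt_def zi zp.
  have /factor_theorem[W hW] : root (pcvec A J d i) a.
    by rewrite rootE pcvecE hc mxE zi mulr0.
  exists (1%N, (g, W)); rewrite /= expr1 -expr2; split => //; last by rewrite hW mulrC.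
  by rewrite q0E zi polyC0 add0r mxE zi eqxx scale1r mulrC.
have H i : nearp 0 (fun t => 0 < g.[a] * ((UW i).2.1.[a] + t * (UW i).2.2.[a])).
  have [_ _ h] := hUW i.
  pose P := (g.[a] * (UW i).2.1.[a])%:P + (g.[a] * (UW i).2.2.[a]) *: 'X.
  have P0 : P.[0] = g.[a] * (UW i).2.1.[a] by rewrite !hornerE.
  have := @nearp_sgz R P 0; rewrite P0 (gt_eqF h) => /(_ isT).
  apply: nearpW => t; rewrite (gtr0_sgz h) => ht.
  have -> : g.[a] * ((UW i).2.1.[a] + t * (UW i).2.2.[a]) = P.[t].
    by rewrite /P hornerD hornerC hornerZ hornerX; ring.
  by rewrite -sgz_gt0 ht ltr01.
have [t tt [/(_ (negbT (gt_eqF tt))) gq ht]] := nearp_right (nearp_and (hd q0) (nearp_all H)).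
exists (q0 + t *: d) => //.
have K i : nearp a (fun x => sgz (g * ((UW i).2.1 + t *: (UW i).2.2)).[x] =
    sgz (g * ((UW i).2.1 + t *: (UW i).2.2)).[a]).
  by apply: nearp_sgz; rewrite hornerM hornerD hornerZ gt_eqF.
apply: nearpW (nearp_all K) => x h xa i; have [h1 h2 _] := hUW i.
have : 0 < (g * ((UW i).2.1 + t *: (UW i).2.2)).[x].
  by rewrite -sgz_gt0 h sgz_gt0 hornerM hornerD hornerZ.
rewrite cvecD -!pcvecE -pcdetE h1 h2 gE hornerM hornerD hornerZ !hornerM.
rewrite !horner_exp !hornerXsubC => h3.
have xa0 : 0 < x - a by rewrite subr_gt0.
have := mulr_gt0 (exprn_gt0 (UW i).1 xa0) (mulr_gt0 xa0 h3).
by congr (0 < _); ring.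
Qed.

Lemma touched_support A J a : touched A J a -> exists J' (z : 'cV[R]_n),
  [/\ z != 0, forall i, 0 <= z i 0, forall i, i \in J' -> 0 < z i 0 & cmx A J' a *m z = 0].
Proof.
move=> [z [z0 zp Mz]]; exists (finset (fun i => (i \in J) && (z i 0 != 0))), z; split => //.
  by move=> i; rewrite inE => /andP[_ h]; rewrite lt_def h zp.
rewrite -Mz; apply/colP => r; rewrite !mxE; apply: eq_bigr => k _; rewrite !mxE inE.
by case: (eqVneq (z k 0) 0) => [->|]; rewrite ?mulr0// andbT.
Qed.

Definition weight A a : nat := \sum_(J : {set 'I_n}) (if `[< touched A J a >] then evens A J a else 0)%N.

(** The last two clauses yield [1 + d <= 2 * weight]. As the jump does not depend on [q], the last
    one may use the [q] of [special_q]: the term of [J] then drops by one and no other term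
    rises. *)
Lemma local_jump A a : exists d, [/\ has_jump (dg A) a d,
   (forall J, ~ touched A J a) -> d = 0,
   d <= (weight A a)%:Z
 & (exists J, touched A J a) -> weight A a = 0%N -> d <= -1].
Proof.
have [dd /(_ 0) hdd] := good_exists A a.
have [t t0 /(_ (negbT (gt_eqF t0))) gq] := nearp_right hdd.
have [tL [tR st]] := sided_exists gq.
have bound q uL uR : good A a q -> sided A a q uL uR -> forall J,
    uR J - uL J <= (if `[< touched A J a >] then evens A J a else 0)%N%:Z.
  move=> gq' st' J; case: asboolP => [_|nt]; first exact: (sided_bound gq' st').
  have [d0|d0] := eqVneq (cdet A J a) 0; last by rewrite (sided_nonsing gq' st')// subrr.
  have h := sided_touched gq' st' d0.
  have -> : uL J = 0 by apply: contrapT => /eqP k; apply: nt; apply: h; left.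
  by have -> : uR J = 0 by apply: contrapT => /eqP k; apply: nt; apply: h; right.
exists (\sum_J (tR J - tL J)); split.
- exact: (has_jump_sided gq st).
- move=> nt; rewrite big1// => J _.
  have [d0|d0] := eqVneq (cdet A J a) 0; last by rewrite (sided_nonsing gq st)// subrr.
  have h := sided_touched gq st d0.
  have -> : tL J = 0 by apply: contrapT => /eqP k; apply: (nt J); apply: h; left.
  by have -> : tR J = 0 by apply: contrapT => /eqP k; apply: (nt J); apply: h; right.
- by rewrite /weight (big_morph Posz PoszD (erefl _)); apply: ler_sum => J _; apply: bound gq st J.
move=> [J0 tJ0] w0.
have ev0 J : touched A J a -> evens A J a = 0%N.
  move=> tJ; move: w0 => /eqP; rewrite /weight sum_nat_eq0 => /forallP/(_ J) /=.
  by case: asboolP => // _ /eqP.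
have [J [z [z0 zp zJ Mz]]] := touched_support tJ0.
have tJ : touched A J a by exists z.
have d0 := cmx_kernel_cdet z0 Mz.
(* Two consecutive positions always include an even one. *)
have m1 : count_mem a (rts A J) = 1%N.
  have : (0 < count_mem a (rts A J))%N by rewrite -has_count has_pred1 -cdet_eq0 d0 eqxx.
  have := ev0 J tJ; rewrite /evens count_le_lt; move: (count _ _) (count_mem _ _) => r m.
  have := odd_double_half r; have := odd_double_half (r + m).
  by rewrite -!muln2; case: odd; case: odd; lia.
have [q gq' pos] := special_q z0 zp zJ Mz m1.
have [uL [uR st']] := sided_exists gq'.
rewrite (has_jump_uniq (has_jump_sided gq st) (has_jump_sided gq' st')).
rewrite (bigD1 J)//= (sided_strict gq' st' d0 (ev0 J tJ)).
  rewrite -[leRHS]addr0 lerD2l; apply: sumr_le0 => J' _.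
  apply: le_trans (bound _ _ _ gq' st' J') _.
  by case: asboolP => [/ev0 ->|].
have [x xa [h1 h2]] := nearp_right (nearp_and st' pos).
rewrite -(h1 J).2// /term /sterm; case: forallP => [_|[]]; last first.
  by move=> i; rewrite -sgzM sgz_gt0 h2.
rewrite mulf_neq0 ?signr_eq0// sgz_eq0.
have [i zi] := cV_neq0_ex z0.
by apply: contraTneq (h2 xa i) => ->; rewrite mul0r ltxx.
Qed.

End Special.

(** * Global counting *)


Section Global.
Variables (R : rcfType) (n : nat).
Implicit Types (J : {set 'I_n}) (A : 'M[R]_n) (q : 'cV[R]_n) (a x y : R).

Definition pareto A a := exists J, touched A J a.

Lemma pareto_singular A a : pareto A a -> ~ nonsing A a.
Proof.
by move=> [J [z [z0 _ Mz]]] /(_ J); rewrite (cmx_kernel_cdet z0 Mz) eqxx.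
Qed.

Definition jump A a : int := sval (cid (local_jump A a)).

Lemma jumpP A a : [/\ has_jump (dg A) a (jump A a), ~ pareto A a -> jump A a = 0,
  jump A a <= (weight A a)%:Z & pareto A a -> weight A a = 0%N -> jump A a <= -1].
Proof.
rewrite /jump; case: (svalP (cid (local_jump A a))) => h1 h2 h3 h4; split => //.
by move=> np; apply: h2 => J tJ; apply: np; exists J.
Qed.

Lemma generic_exists2 A x y : nonsing A x -> nonsing A y ->
  exists2 q, generic A x q & generic A y q.
Proof.
move=> dx dy.
pose L (t : bool * ({set 'I_n} * 'I_n)) :=
  row t.2.2 (\adj (cmx A t.2.1 (if t.1 then x else y))).
have [|d hd] := @linear_forms_avoid _ _ _ L.
  by move=> [[] [J i]]; rewrite /L rowE row_adj_neq0// delta_row_neq0.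
by exists d => J i; rewrite cvec_rowE; [apply: (hd (true, (J, i)))|apply: (hd (false, (J, i)))].
Qed.

Lemma dg_increment A x y : x <= y -> nonsing A x -> nonsing A y ->
  exists s : seq R, [/\ uniq s, forall a, pareto A a -> a \in s &
    dg A y - dg A x = \sum_(a <- s | x < a < y) jump A a].
Proof.
move=> xy dx dy; have [q gx gy] := generic_exists2 dx dy.
pose P (t : {set 'I_n} * 'I_n + {set 'I_n}) :=
  match t with inl t => pcvec A t.1 q t.2 | inr J => pcdet A J end.
have P0 t : P t != 0.
  case: t => [[J i]|J]; last exact: pcdet_neq0.
  by apply/eqP => /= /(congr1 (horner^~ x))/eqP; rewrite pcvecE horner0 (negPf (gx J i)).
have [s us hs] := roots_seq P0.
have hs' a : a \notin s -> nonsing A a /\ generic A a q.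
  move/hs => h; split => [J|J i]; first by rewrite -pcdetE; apply: (h (inr J)).
  by rewrite -pcvecE; apply: (h (inl (J, i))).
exists s; split => //.
  by move=> a pa; apply: contrapT => /negP/hs'[/(pareto_singular pa)].
apply: (jump_sum us _ _ xy).
- by move=> a _; have [] := jumpP A a.
- move=> u v uv h.
  have [du gu] := hs' u (h u (introT andP (conj (lexx u) uv))).
  have [dv gv] := hs' v (h v (introT andP (conj uv (lexx v)))).
  rewrite (dgE du gu) (dgE dv gv).
  have := @deg_const_interval R n (map_mx polyC A) 'X (map_mx polyC q) u v uv.
  rewrite !mev_const !hornerX => -> // z /h/hs'; by rewrite !mev_const hornerX.
- by apply/hs => -[[J i]|J] /=; rewrite ?pcvecE ?pcdetE.
- by apply/hs => -[[J i]|J] /=; rewrite ?pcvecE ?pcdetE.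
Qed.

(** Let [s] be the sum of the absolute values of the entries on [J]. The rows of [J] give
    [|x| s <= n + K s], and the size of [|x|] then gives [K s <= 1], so that every right-hand side
    [1 + S i] is positive. *)
Lemma far_solution A : exists2 B, 0 < B & forall J x (z : 'cV[R]_n), B < `|x| ->
  cmx A J x *m z = const_mx 1 ->
  (forall i, i \in J -> 0 < x * z i 0) /\ (forall i, i \notin J -> 0 < z i 0).
Proof.
pose K : R := \sum_i \sum_j `|A i j| + 1.
have K1 : 1 <= K by rewrite lerDr; apply: sumr_ge0 => i _; apply: sumr_ge0.
exists (n.+1%:R * K) => [|J x z Bx Mz]; first by rewrite mulr_gt0 ?ltr0Sn// (lt_le_trans ltr01).
pose S i := \sum_(j in J) A i j * z j 0.
have row i : (if i \in J then x else 1) * z i 0 = 1 + S i.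
  have /eqP := cmx_mulE A J x z i; rewrite Mz mxE eq_sym subr_eq -/(S i) => /eqP <-.
  by case: ifP; rewrite ?mul1r.
pose s := \sum_(j in J) `|z j 0|.
have s0 : 0 <= s by apply: sumr_ge0.
have K0 : 0 < K by rewrite (lt_le_trans ltr01).
have AK i j : `|A i j| <= K - 1.
  rewrite /K addrK (bigD1 i)//= (bigD1 j)//= -addrA lerDl addr_ge0//.
    by apply: sumr_ge0.
  by apply: sumr_ge0 => k _; apply: sumr_ge0.
have SK i : `|S i| <= (K - 1) * s.
  apply: le_trans (ler_norm_sum _ _ _) _; rewrite mulr_sumr; apply: ler_sum => j _.
  by rewrite normrM ler_wpM2r.
have sE : `|x| * s <= n%:R + K * s.
  rewrite mulr_sumr.
  have : \sum_(j in J) `|x| * `|z j 0| <= \sum_(j in J) (1 + `|S j|).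
    apply: ler_sum => j jJ; have := row j; rewrite jJ -normrM => ->.
    by apply: le_trans (ler_normD _ _) _; rewrite normr1.
  move=> /le_trans; apply; rewrite big_split /=; apply: lerD.
    rewrite sumr_const ler_nat; rewrite -[X in (_ <= X)%N](card_ord n); exact: max_card.
  apply: (@le_trans _ _ (\sum_i \sum_(j in J) `|A i j| * `|z j 0|)).
    rewrite [leRHS](bigID (mem J)) /=; rewrite -[leLHS]addr0; apply: lerD.
      apply: ler_sum => i _; apply: le_trans (ler_norm_sum _ _ _) _.
      by apply: ler_sum => j _; rewrite normrM.
    by apply: sumr_ge0 => i _; apply: sumr_ge0 => j _; rewrite mulr_ge0.
  rewrite exchange_big mulr_sumr; apply: ler_sum => j _; rewrite -mulr_suml ler_wpM2r//.
  rewrite /K -[leLHS]addr0; apply: lerD => //; apply: ler_sum => i _.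
  by rewrite (bigD1 j)//= lerDl sumr_ge0.
have Ks : (K - 1) * s < 1.
  have h : (n.+1%:R * K - K) * s <= n%:R.
    apply: le_trans (_ : (`|x| - K) * s <= _); first by rewrite ler_wpM2r// lerD2r ltW.
    by rewrite mulrBl lerBlDr.
  have n0 : 0 <= n%:R :> R by rewrite ler0n.
  have [n0'|n1] := leqP n 0.
    have -> : s = 0 by rewrite /s big1// => j; have := ltn_ord j; rewrite ltnNge (leq_trans n0').
    by rewrite mulr0.
  have n1' : 1 <= n%:R :> R by rewrite ler1n.
  have h2 : K * s <= 1.
    have : n%:R * (K * s) <= n%:R * 1 by rewrite mulr1; apply: le_trans h; rewrite -natr1; lra.
    by rewrite ler_pM2l// (lt_le_trans ltr01).
  have [s1|s1] := eqVneq s 0; first by rewrite s1 mulr0.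
  have : 0 < s by rewrite lt_def s1. 
  lra.
have pos i : 0 < 1 + S i by have := SK i; rewrite ler_norml => /andP[h _]; lra.
by split=> i iJ; have := row i; rewrite ?iJ ?(negPf iJ) ?mul1r => ->.
Qed.

Lemma sum_signs (i0 : 'I_n) : \sum_(J : {set 'I_n}) (-1) ^+ #|J| = 0 :> int.
Proof.
have : \sum_(J : {set 'I_n}) (-1) ^+ #|J| = - \sum_(J : {set 'I_n}) (-1) ^+ #|J| :> int.
  rewrite {1}(reindex_inj (inv_inj (flipK i0))) -sumrN.
  by apply: eq_bigr => J _; rewrite sign_flip.
by move: (\sum_J _) => k; lia.
Qed.

(** Take the all-ones vector for [q]. Far to the left only the empty set has a positive solution;
    far to the right all sets do, and their signs [(-1)^|J|] cancel. *)
Lemma dg_ends A (i0 : 'I_n) (s : seq R) : exists x y,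
  [/\ forall a, a \in s -> x < a < y, x <= y, nonsing A x, nonsing A y & (dg A x = 1) /\ (dg A y = 0)].
Proof.
have [B B0 hB] := far_solution A.
pose t := s ++ flatten [seq rts A J | J <- enum {set 'I_n}].
have [M M0 hM] : exists2 M, 0 < M & forall a, a \in t -> `|a| < M.
  elim: t => [|b t [M M0 IH]]; first by exists 1.
  exists (Num.max M (`|b| + 1)); first by rewrite lt_max M0.
  move=> a; rewrite inE => /orP[/eqP ->|/IH h]; rewrite lt_max; last by rewrite h.
  by rewrite ltrDl ltr01 orbT.
pose m := Num.max M B + 1.
have mM : M < m by rewrite ltr_pwDr// le_max lexx.
have mB : B < m by rewrite ltr_pwDr// le_max lexx orbT.
have rt J a : a \in rts A J -> - m < a < m.
  move=> h; rewrite -ltr_norml; apply: lt_trans mM; apply: hM; rewrite mem_cat; apply/orP; right.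
  by apply/flattenP; exists (rts A J) => //; apply: map_f; rewrite mem_enum.
have ns x : `|x| = m -> nonsing A x.
  move=> xm J; rewrite cdet_eq0; apply/negP => /rt; rewrite -ltr_norml xm ltxx //.
have m0 : 0 < m by rewrite (lt_trans M0).
have key J x : `|x| = m -> exists z : 'cV[R]_n,
    [/\ forall i, cvec A J x (const_mx 1) i 0 = cdet A J x * z i 0,
     forall i, i \in J -> 0 < x * z i 0 & forall i, i \notin J -> 0 < z i 0].
  move=> xm; exists ((cdet A J x)^-1 *: cvec A J x (const_mx 1)).
  have d0 := ns x xm J.
  have e1 : cmx A J x *m ((cdet A J x)^-1 *: cvec A J x (const_mx 1)) = const_mx 1.
    by rewrite -scalemxAr mul_cmx_cvec scalerA mulVf// scale1r.
  have xB : B < `|x| by rewrite xm.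
  have [h1 h2] := hB J x _ xB e1.
  by split=> // i; rewrite [in RHS]mxE mulrA mulfV// mul1r.
have gen x : `|x| = m -> generic A x (const_mx 1).
  move=> xm J i; have [z [-> h1 h2]] := key J x xm; apply: mulf_neq0; first exact: ns.
  have [iJ|iJ] := boolP (i \in J); last by rewrite gt_eqF// h2.
  by apply: contraTneq (h1 i iJ) => ->; rewrite mulr0 ltxx.
have nm : `|- m| = m by rewrite normrN gtr0_norm.
have pm : `|m| = m by rewrite gtr0_norm.
exists (- m), m; split.
- by move=> a h; rewrite -ltr_norml; apply: lt_trans mM; apply: hM; rewrite mem_cat h.
- by lra.
- exact: ns.
- exact: ns.
split.
  rewrite (dgE (ns _ nm) (gen _ nm)) /deg (bigD1 finset.set0)//= big1 => [|J J0].
    rewrite addr0 /term /sterm.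
    have c1 : cdet A finset.set0 (- m) = 1.
      rewrite /cdet -(det1 R n); congr (\det _); apply/matrixP => i j.
      by rewrite !mxE finset.in_set0.
    have [z [h1 h2 h3]] := key finset.set0 _ nm.
    rewrite c1 cards0 expr0 sgz1 mul1r; case: forallP => // -[] i.
    by rewrite mul1r sgz_gt0 h1 c1 mul1r h3// finset.in_set0.
  rewrite /term /sterm; case: forallP => // h.
  have [z [h1 h2 h3]] := key J _ nm.
  have [i iJ] : exists i, i \in J by apply/finset.set0Pn.
  have := h i; rewrite -sgzM sgz_gt0 h1 mulrA pmulr_rgt0 => [zi|]; last first.
    by rewrite -expr2 exprn_even_gt0//= ns.
  by have := h2 i iJ; rewrite mulNr oppr_gt0 pmulr_rlt0// ltNge ltW.
rewrite (dgE (ns _ pm) (gen _ pm)) /deg; apply: etrans (sum_signs i0); apply: eq_bigr => J _.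
have [z [h1 h2 h3]] := key J _ pm.
rewrite /term /sterm; case: forallP => [_|[] i]; last first.
  rewrite -sgzM sgz_gt0 h1 mulrA mulr_gt0//; first by rewrite -expr2 exprn_even_gt0//= ns.
  by have [iJ|/h3//] := boolP (i \in J); rewrite -(pmulr_rgt0 _ m0) h2.
rewrite sgz_cdet -?cdet_eq0 ?ns//.
have [h [_ _ _ _ o]] := rtsP A J.
rewrite -signr_odd -[RHS]signr_odd -o; congr (_ ^+ odd _).
rewrite -[RHS](count_predT); apply: eq_in_count => a /rt /=; lra.
Qed.

End Global.


(** * Counting Pareto eigenvalues by even positions *)

Section Count.
Variables (R : rcfType) (n : nat).
Implicit Types (J : {set 'I_n}) (A D : 'M[R]_n) (a x y : R) (s : seq R).

(** Distinct values occupy disjoint blocks of positions, so the sum is bounded by telescoping along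
    the sorted list. The strengthened claim adds [c a], the even positions below the first value. *)
Lemma sum_evens A J s : uniq s -> (\sum_(a <- s) evens A J a <= #|J|./2)%N.
Proof.
move=> us; have [_ [_ _ _ sz _]] := rtsP A J; apply: leq_trans (half_leq sz) => {sz}.
rewrite -(perm_big _ (permEl (perm_sort <=%R s))) /=.
have : sorted <%R (sort <=%R s) by rewrite lt_sorted_uniq_le sort_uniq us sort_sorted//; apply: le_total.
rewrite /evens; move: (rts A J) => t; case: (sort _ s) => [|a l]; first by rewrite big_nil.
pose c x := (count (fun b => (b < x)%R) t)./2; pose d x := (count (fun b => (b <= x)%R) t)./2.
suff: sorted <%R (a :: l) -> (\sum_(b <- a :: l) (d b - c b) + c a <= (size t)./2)%N.
  by move=> h /h; apply: leq_trans; apply: leq_addr.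
have cd b : (c b <= d b)%N by apply: half_leq; apply: sub_count => x /ltW.
elim: l a => [|b l IH] a.
  by move=> _; rewrite big_seq1 subnK//; apply: half_leq; apply: count_size.
move=> /= /andP[ab /IH h]; rewrite big_cons addnAC subnK//.
apply: leq_trans h; rewrite addnC leq_add2l; apply: half_leq; apply: sub_count => x /= xa.
exact: le_lt_trans ab.
Qed.

Definition used A s J : nat := (\sum_(a <- s) (if `[< touched A J a >] then evens A J a else 0))%N.

Lemma used_le A s J : uniq s -> (used A s J <= #|J|./2)%N.
Proof.
move=> us; apply: leq_trans (sum_evens A J us).
by apply: leq_sum => a _; case: ifP.
Qed.

Lemma sum_weight A s : (\sum_(a <- s) weight A a = \sum_(J : {set 'I_n}) used A s J)%N.
Proof. by rewrite /weight /used exchange_big. Qed.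

Lemma pareto_list A (i0 : 'I_n) : exists s, [/\ uniq s, forall a, pareto A a <-> a \in s
  & \sum_(a <- s) jump A a = -1].
Proof.
pose t := flatten [seq rts A J | J <- enum {set 'I_n}].
have tP a : pareto A a -> a \in t.
  move=> /pareto_singular; apply: contra_notT => ant J; rewrite cdet_eq0.
  apply: contraNN ant => h; apply/flattenP; exists (rts A J) => //.
  by apply: map_f; rewrite mem_enum.
have [x [y [hxy xy dx dy [ex ey]]]] := dg_ends A i0 t.
have [s [us sP]] := dg_increment xy dx dy; rewrite ex ey sub0r => e.
exists [seq a <- s | `[< pareto A a >]]; split; first exact: filter_uniq.
  move=> a; rewrite mem_filter; split => [pa|/andP[/asboolP//]].
  by rewrite asboolT//= sP.
rewrite big_filter e big_mkcond [RHS]big_mkcond; apply: eq_bigr => a _.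
case: asboolP => [pa|npa]; first by rewrite hxy// tP.
by have [_ -> //] := jumpP A a; case: ifP.
Qed.

Lemma jump_weight A a : pareto A a -> 1 + jump A a <= (2 * weight A a)%N%:Z.
Proof.
move=> pa; have [_ _ h1 /(_ pa) h2] := jumpP A a.
have [w0|w0] := eqVneq (weight A a) 0%N; first by have := h2 w0; rewrite w0; lia.
lia.
Qed.

Let W := (\sum_(J : {set 'I_n}) #|J|./2)%N.

(** The left-hand side is the sum of the defects in [jump_weight], all nonnegative; extremal cases
    are read off from it. *)
Lemma count_excess A s : uniq s -> (forall a, pareto A a <-> a \in s) ->
  \sum_(a <- s) jump A a = -1 ->
  \sum_(a <- s) ((2 * weight A a)%N%:Z - (1 + jump A a)) =
    (2 * \sum_(J : {set 'I_n}) used A s J)%N%:Z - (size s)%:Z + 1.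
Proof.
move=> us sP e; rewrite sumrB big_split /= e -sum_weight big_distrr /=.
rewrite (big_morph Posz PoszD (erefl _)) [X in _ - (X + _)]big_const_seq count_predT.
by rewrite iter_addr_0 natz opprB addrA addrAC.
Qed.

Lemma used_total A s : uniq s -> (\sum_(J : {set 'I_n}) used A s J <= W)%N.
Proof. by move=> us; apply: leq_sum => J _; apply: used_le. Qed.

(** A zero jump has an odd, hence positive, defect, so two of them make the total defect at least
    2. *)
Lemma folds_le A s a b : uniq s -> (forall a, pareto A a <-> a \in s) ->
  \sum_(a <- s) jump A a = -1 -> a \in s -> b \in s -> a != b ->
  jump A a = 0 -> jump A b = 0 -> (size s < 2 * W)%N.
Proof.
move=> us sP e as_ bs ab ja jb; have := count_excess us sP e; have UT := used_total A us.
have pos c : c \in s -> 0 <= (2 * weight A c)%N%:Z - (1 + jump A c).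
  by move=> /sP/jump_weight; lia.
rewrite (bigD1_seq a as_ us)/= -[X in _ + X = _](big_filter s (fun i => i != a)) (bigD1_seq b)/= ?filter_uniq//; last first.
  by rewrite mem_filter eq_sym ab.
rewrite ja jb.
have : 0 <= \sum_(i <- [seq i <- s | i != a] | i != b) ((2 * weight A i)%N%:Z - (1 + jump A i)).
  rewrite big_seq_cond; apply: sumr_ge0 => c /andP[+ _]; rewrite mem_filter => /andP[_].
  exact: pos.
have := pos a as_; have := pos b bs; rewrite ja jb.
move: UT; move: (\sum_(i <- [seq i <- s | i != a] | _) _) => k; move: (\sum_(J : {set 'I_n}) used A s J)%N => u; lia.
Qed.

(** As the total defect is nonnegative, twice the sum of the [used] is at least [2 * W - 1]. By
    parity the sum equals [W], and every bound [used_le] is an equality. *)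
Lemma used_full A s J : uniq s -> (forall a, pareto A a <-> a \in s) ->
  \sum_(a <- s) jump A a = -1 -> (2 * W <= size s)%N -> used A s J = #|J|./2.
Proof.
move=> us sP e sz; have := count_excess us sP e.
have : 0 <= \sum_(a <- s) ((2 * weight A a)%N%:Z - (1 + jump A a)).
  rewrite big_seq; apply: sumr_ge0 => c /sP/jump_weight; lia.
move=> h h2; apply/eqP; rewrite eqn_leq used_le//=.
have : (\sum_(J' : {set 'I_n} | J' != J) used A s J' <= \sum_(J' : {set 'I_n} | J' != J) #|J'|./2)%N.
  by apply: leq_sum => J' _; apply: used_le.
move: sz h h2; rewrite /W (bigD1 J)//= (bigD1 J (P := predT) (F := fun J => used A s J))//=.
move: (\sum_(a <- s) _) (\sum_(J' | J' != J) used _ _ _)%N (\sum_(J' | J' != J) _)%N => k u v.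
lia.
Qed.

Lemma used_ex A s J : used A s J <> 0%N -> exists2 a, touched A J a & (0 < evens A J a)%N.
Proof.
move=> h; apply: contrapT => k; apply: h; rewrite /used big1// => a _.
case: asboolP => // ta; apply/eqP; rewrite -leqn0 leqNgt; apply/negP => ea.
by apply: k; exists a.
Qed.

(** The degrees at nonsingular points on both sides of [a] survive a small perturbation, and they
    differ, so the perturbed matrix has a jump in between. *)
Lemma jump_persists A D a eps : jump A a != 0 -> 0 < eps ->
  nearp 0 (fun t => exists2 b, pareto (A + t *: D) b & `|b - a| < eps).
Proof.
move=> j0 eps0; have [[e e0 he] _ _ _] := jumpP A a.
have [f f0 hf] := near_nonsing A a.
have [d [d0 d1 d2 d3]] : exists d, [/\ 0 < d, d < e, d < f & d < eps].
  have h : 0 < Num.min e (Num.min f eps) by rewrite !lt_min e0 f0.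
  exists (Num.min e (Num.min f eps) / 2).
  have : Num.min e (Num.min f eps) <= e by rewrite ge_min lexx.
  have : Num.min e (Num.min f eps) <= f by rewrite !ge_min lexx orbT.
  have : Num.min e (Num.min f eps) <= eps by rewrite !ge_min lexx !orbT.
  by move: (Num.min _ _) h => m h h1 h2 h3; split; lra.
have stable x : nonsing A x -> nearp 0 (fun t => nonsing (A + t *: D) x /\ dg (A + t *: D) x = dg A x).
  move=> nx; have [q gq] := generic_exists nx.
  pose P := map_mx polyC A + 'X *: map_mx polyC D : 'M[{poly R}]_n.
  have PE t : mev P t = A + t *: D by apply/matrixP => i j; rewrite !mxE /horner_eval !hornerE.
  have := @near_deg R n P x%:P (map_mx polyC q) 0.
  rewrite PE scale0r addr0 mev_const hornerC => /(_ nx gq).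
  apply: nearpW => t; rewrite PE mev_const hornerC => -[h1 h2 h3]; split=> //.
  by rewrite (dgE h1 h2) h3 (dgE nx gq).
have nx : nonsing A (a - d) by apply: hf; [rewrite ltr_norml; lra|rewrite lt_eqF//; lra].
have ny : nonsing A (a + d) by apply: hf; [rewrite ltr_norml; lra|rewrite gt_eqF//; lra].
apply: nearpW (nearp_and (stable _ nx) (stable _ ny)) => t [[n1 e1] [n2 e2]].
have xy : a - d <= a + d by lra.
have [s [us sP]] := dg_increment xy n1 n2; rewrite e1 e2 he; try lra.
move=> js; apply: contrapT => k; case/negP: j0; apply/eqP; rewrite js big1_seq// => b /andP[hb _].
have [_ + _ _] := jumpP (A + t *: D) b; apply => pb; apply: k; exists b => //.
by rewrite ltr_norml; lra.
Qed.

End Count.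

(** * Perturbation to a generic matrix *)


Section Generic.
Variable R : rcfType.

(* [crossG A i j k] vanishes when the vector [(A j k, - A j i)], which has zero slack in
   row [j], is an eigenvector of the submatrix indexed by [{i, k}]. *)
Definition crossG (K : comNzRingType) n (A : 'M[K]_n) i j k : K :=
  (A k k - A i i) * (A j i * A j k) + A i k * A j i ^+ 2 - A k i * A j k ^+ 2.

Definition gen_mx n (A : 'M[R]_n) := (forall i j, i != j -> A i j != 0) /\
  (forall i j k, i != j -> j != k -> i != k -> crossG A i j k != 0).

Lemma crossG_scale n (A : 'M[R]_n) t i j k : crossG (t *: A) i j k = t ^+ 3 * crossG A i j k.
Proof. by rewrite /crossG !mxE; ring. Qed.

Lemma crossG_ev n (A : 'M[{poly R}]_n) t i j k : crossG (mev A t) i j k = (crossG A i j k).[t].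
Proof. by rewrite /crossG !mxE /horner_eval !hornerE. Qed.

(** Since [crossG] is homogeneous of degree 3, its value at [A + t D] has leading coefficient
    [crossG D]; the reversed pencil [t A + D] shows that this polynomial is not zero. *)
Lemma gen_mx_near n (A D : 'M[R]_n) : gen_mx D -> nearp 0 (fun t => t != 0 -> gen_mx (A + t *: D)).
Proof.
move=> [D1 D2].
pose P := map_mx polyC A + 'X *: map_mx polyC D : 'M[{poly R}]_n.
have PE t : mev P t = A + t *: D by apply/matrixP => i j; rewrite !mxE /horner_eval !hornerE.
pose Q := 'X *: map_mx polyC A + map_mx polyC D : 'M[{poly R}]_n.
have QE t : mev Q t = t *: A + D by apply/matrixP => i j; rewrite !mxE /horner_eval !hornerE.
have H1 (t : {p : 'I_n * 'I_n | p.1 != p.2}) : P (sval t).1 (sval t).2 != 0.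
  case: t => [[i j] /= ij]; apply: contraNneq (D1 i j ij) => /(congr1 (fun p : {poly R} => p`_1)).
  by rewrite !mxE !coefE/= add0r mul1r => ->.
have H2 (t : {p : 'I_n * 'I_n * 'I_n | [&& p.1.1 != p.1.2, p.1.2 != p.2 & p.1.1 != p.2]}) :
    crossG P (sval t).1.1 (sval t).1.2 (sval t).2 != 0.
  case: t => [[[i j] k] /= /and3P[ij jk ik]].
  have q0 : (crossG Q i j k).[0] != 0 by rewrite -crossG_ev QE scale0r add0r D2.
  have [t t0] := nearp_right (nearp_sgz q0).
  move=> /(congr1 (fun x => x == 0)); rewrite !sgz_eq0 (negPf q0) -crossG_ev QE => h.
  apply/eqP => /(congr1 (horner^~ t^-1)); rewrite -crossG_ev PE horner0.
  have -> : A + t^-1 *: D = t^-1 *: (t *: A + D).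
    by rewrite scalerDr scalerA mulVf ?scale1r// gt_eqF.
  by rewrite crossG_scale => /eqP; rewrite mulf_eq0 h expf_eq0 /= invr_eq0 gt_eqF.
have N1 := polys_avoid H1 0; have N2 := polys_avoid H2 0.
apply: nearpW (nearp_and N1 N2) => t [h1 h2] t0; split=> [i j ij|i j k ij jk ik].
  have := h1 t0 (exist _ (i, j) ij); rewrite -PE !mxE //.
have h : [&& i != j, j != k & i != k] by rewrite ij jk ik.
by have := h2 t0 (exist _ (i, j, k) h); rewrite -PE crossG_ev.
Qed.

(** Off the diagonal the entries are positive, and such that [crossG] is nonzero for each of the 16
    diagonals of [base_fun], which [base_checkP] verifies by computation. *)
Definition base_entry (i j : nat) : int :=
  nth 0 (nth [::] [:: [:: 0; 3; 2; 1]; [:: 1; 0; 3; 2]; [:: 2; 1; 0; 3]; [:: 2; 3; 1; 0]] i) j.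

(* The diagonal is chosen so that the indicator vector of [b] is annihilated by the
   rows in [b]. *)
Definition base_fun (b : nat -> bool) (i j : nat) : int :=
  if i == j then - \sum_(l <- iota 0 4) (if b l then base_entry i l else 0) else base_entry i j.

Definition base_mx (J : {set 'I_4}) : 'M[R]_4 :=
  \matrix_(i, j) (base_fun (fun l => if insub l is Some k then k \in J else false) i j)%:~R.

Definition base_check (b : nat -> bool) : bool :=
  all (fun i => all (fun j => all (fun k => [&& i != j, j != k & i != k] ==>
    ((base_fun b k k - base_fun b i i) * (base_fun b j i * base_fun b j k)
      + base_fun b i k * base_fun b j i ^+ 2 - base_fun b k i * base_fun b j k ^+ 2 != 0))
    (iota 0 4)) (iota 0 4)) (iota 0 4).

Lemma base_checkP b : base_check b.
Proof.
pose b' l := nth false [:: b 0; b 1; b 2; b 3]%N l.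
have -> : base_check b = base_check b'.
  rewrite /base_check /base_fun unlock /=.
  reflexivity.
rewrite /b'; case: (b 0%N); case: (b 1%N); case: (b 2%N); case: (b 3%N);
  rewrite /base_check /base_fun unlock; vm_compute; reflexivity.
Qed.

Lemma base_mx_gen J : gen_mx (base_mx J).
Proof.
split=> [i j ij|i j k ij jk ik].
  rewrite mxE intr_eq0 /base_fun (negPf (ij : (i : nat) != j)).
  by case: i j ij => [[|[|[|[|//]]]] ?] [[|[|[|[|//]]]] ?].
have -> : crossG (base_mx J) i j k = (crossG (\matrix_(i < 4, j < 4)
    base_fun (fun l => if insub l is Some k then k \in J else false) i j) i j k)%:~R.
  by rewrite /crossG !mxE !(rmorphB, rmorphD, rmorphM, rmorphXn).
rewrite intr_eq0 /crossG !mxE.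
have m (u : 'I_4) : (u : nat) \in iota 0 4 by rewrite mem_iota ltn_ord.
have /allP/(_ _ (m i))/allP/(_ _ (m j))/allP/(_ _ (m k)) :=
  base_checkP (fun l => if insub l is Some k then k \in J else false).
by rewrite ij jk ik.
Qed.

Lemma base_mx_row (J : {set 'I_4}) i :
  \sum_(j in J) base_mx J i j = if i \in J then 0 else \sum_(j in J) (base_entry i j)%:~R.
Proof.
pose b l := if insub l is Some k then k \in J else false.
have bE (j : 'I_4) : b j = (j \in J) by rewrite /b valK.
have dE : base_fun b i i = - \sum_(j in J) base_entry i j.
  rewrite /base_fun eqxx -[iota 0 4]/(index_iota 0 4) big_mkord [in RHS]big_mkcond /=.
  by congr (- _); apply: eq_bigr => j _; rewrite bE.
have oE (j : 'I_4) : j != i -> base_mx J i j = (base_entry i j)%:~R.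
  by move=> ji; rewrite mxE /base_fun (negPf (_ : (i : nat) != j)) // eq_sym.
have e0 : base_entry i i = 0 by case: i {dE oE} => [[|[|[|[|//]]]] ?].
case: ifP => iJ; last first.
  by apply: eq_bigr => j jJ; rewrite oE//; apply: contraTneq jJ => ->; rewrite iJ.
rewrite (bigD1 i)//= (eq_bigr (fun j : 'I_4 => (base_entry i j)%:~R : R)); last first.
  by move=> j /andP[_ ji]; rewrite oE.
rewrite mxE -/b dE (bigD1 i)//= e0 add0r rmorphN rmorph_sum /=.
by rewrite addNr.
Qed.

Lemma base_entry_ge0 (i j : nat) : 0 <= base_entry i j.
Proof.
rewrite /base_entry.
by case: i => [|[|[|[|i]]]]; case: j => [|[|[|[|j]]]]; rewrite //= ?nth_nil.
Qed.

Definition scaled_mx (u : 'I_4 -> R) (B : 'M[R]_4) : 'M[R]_4 := \matrix_(i, j) (u i * B i j / u j).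

Lemma scaled_mx_gen u B : (forall i, u i != 0) -> gen_mx B -> gen_mx (scaled_mx u B).
Proof.
move=> u0 [B1 B2]; split=> [i j ij|i j k ij jk ik].
  by rewrite mxE !mulf_neq0// ?B1// invr_eq0.
have -> : crossG (scaled_mx u B) i j k = u j ^+ 2 / (u i * u k) * crossG B i j k.
  by rewrite /crossG !mxE; field; rewrite !u0.
by rewrite mulf_neq0 ?B2// mulf_neq0 ?expf_neq0// invr_eq0 mulf_neq0.
Qed.

(** [D] is a diagonal conjugate of [base_mx K] adapted to [z]. Adding [t *: D] changes nothing in
    the rows of [K] and adds the nonnegative [c] to the slack in the others, so [a] stays a Pareto
    eigenvalue. *)
Lemma touched_perturb (A : 'M[R]_4) J a : touched A J a -> exists2 D : 'M[R]_4, gen_mx D &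
  forall t, 0 <= t -> pareto (A + t *: D) a.
Proof.
move=> /touched_support[K [z [z0 zp zK Mz]]].
pose u i := if i \in K then z i 0 else 1.
have u0 i : 0 < u i by rewrite /u; case: ifP => // /zK.
exists (scaled_mx u (base_mx K)).
  by apply: scaled_mx_gen (base_mx_gen K) => i; rewrite gt_eqF.
move=> t t0; exists K.
pose c i : R := if i \in K then 0 else t * \sum_(j in K) (base_entry i j)%:~R.
have c0 i : 0 <= c i.
  rewrite /c; case: ifP => // _; rewrite mulr_ge0// sumr_ge0// => j _.
  by rewrite ler0z base_entry_ge0.
exists (z + \col_i c i); split.
- have [i zi] := cV_neq0_ex z0.
  apply/eqP => /colP/(_ i)/eqP; rewrite !mxE paddr_eq0// (negPf zi) //.
- by move=> i; rewrite !mxE addr_ge0.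
have S i : \sum_(j in K) scaled_mx u (base_mx K) i j * z j 0 =
    if i \in K then 0 else \sum_(j in K) (base_entry i j)%:~R.
  rewrite (eq_bigr (fun j => u i * base_mx K i j)) => [|j jK]; last first.
    by rewrite mxE /u jK divfK// gt_eqF// zK.
  by rewrite -mulr_sumr base_mx_row /u; case: ifP => _; rewrite ?mulr0 ?mul1r.
set D := scaled_mx _ _ in S *.
have AE i j : (A + t *: D) i j = A i j + t * D i j by rewrite mxE [X in _ + X]mxE.
have zE j : (z + \col_i c i) j 0 = z j 0 + c j by rewrite mxE [X in _ + X]mxE.
have cmxE B i j : cmx B K a i j = if j \in K then a *+ (i == j) - B i j else (i == j)%:R.
  by rewrite mxE.
rewrite -Mz; apply/colP => i; rewrite mxE [RHS]mxE; apply/eqP; rewrite -subr_eq0 -sumrB; apply/eqP.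
rewrite (eq_bigr (fun j => (if j == i then c i else 0) -
    (if j \in K then t * (D i j * z j 0) else 0))).
  rewrite sumrB -!big_mkcond /= big_pred1_eq -mulr_sumr S /c.
  by case: ifP; rewrite ?mulr0 subrr.
move=> j _; rewrite !cmxE zE AE eq_sym.
case: (eqVneq j i) => [->|_]; case: ifP => jK; rewrite ?mulr1n ?mulr0n.
- have -> : c i = 0 by rewrite /c jK.
  ring.
- ring.
- have -> : c j = 0 by rewrite /c jK.
  ring.
- ring.
Qed.

End Generic.

(** * Generic matrices of order four *)


Section Algebra.
Variable R : realFieldType.

(* [P, Q], [- T, r] and [S, V] are the off-diagonal entries of a matrix of order three with zero
   row sums, [(X, Z)] is an eigenvector of its submatrix indexed by the first and third rows, and
   the conclusion is about the sum of its principal minors of order two. *)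
Lemma scaled_triple (P Q r S V T L X Z : R) :
  0 < P -> 0 < Q -> 0 < r -> 0 < S -> 0 < V -> 0 <= X -> 0 <= Z -> (X != 0) || (Z != 0) ->
  T - r <= - (S + V) -> - (P + Q) * X + Q * Z = L * X -> S * X - (S + V) * Z = L * Z ->
  0 <= - T * X + r * Z ->
  0 < - T * (Q + S + V) + r * (P + Q + S) + P * S + P * V + Q * V.
Proof.
move=> P0 Q0 r0 S0 V0 X0 Z0 XZ ord e1 e2 sl.
have Xp : 0 < X.
  rewrite lt_def X0 andbT; apply/eqP => x0; move: XZ; rewrite x0 eqxx /= => Zn.
  by case/negP: Zn; apply/eqP; apply: (mulfI (lt0r_neq0 Q0)); nra.
have Zp : 0 < Z.
  rewrite lt_def Z0 andbT; apply/eqP => z0; move: e2; rewrite z0 !mulr0 subr0 => /eqP.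
  by rewrite mulf_eq0 !gt_eqF.
have L0 : L < 0.
  case: (leP X Z) => h.
    have : L * Z < 0 * Z by rewrite -e2 mul0r; nra.
    by rewrite ltr_pM2r.
  have : L * X < 0 * X by rewrite -e1 mul0r; nra.
  by rewrite ltr_pM2r.
pose W := L + P + Q.
have WX : W * X = Q * Z by rewrite /W; nra.
have W0 : 0 < W by rewrite -(pmulr_lgt0 _ Xp) WX mulr_gt0.
(* Eliminating [X] and [Z] from the slack inequality by either eigenvector equation gives [h1] and
   [h2]. Their sum and [h3] yield [T * (Q + S + V) <= r * (P + Q + S)]. *)
have h1 : T * Q <= r * W.
  rewrite -(ler_pM2r Zp) (_ : T * Q * Z = W * (T * X)); last by rewrite mulrCA WX; ring.
  by rewrite (_ : r * W * Z = W * (r * Z)); [rewrite ler_pM2l//; lra|ring].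
have h2 : T * (L + S + V) <= r * S.
  rewrite -(ler_pM2r Zp) (_ : T * (L + S + V) * Z = S * (T * X)); last by nra.
  by rewrite (_ : r * S * Z = S * (r * Z)); [rewrite ler_pM2l//; lra|ring].
have h3 : L * (r - T) <= 0 by rewrite nmulr_rle0//; lra.
have : 0 < P * S + P * V + Q * V by rewrite !addr_gt0// mulr_gt0.
move: h1 h2 h3; rewrite /W; nra.
Qed.

(** The letters [p], [q], [r], [s], [v], [b] stand for the entries [ij], [ik], [jk], [ki], [kj],
    [ji]. The last hypothesis says that the characteristic polynomial of the triple has nonpositive
    derivative at [a]; [scaled_triple], fed with the eigenvector [(x, z)] of the pair [ik], makes it
    positive. *)
Lemma triple_contra (aii ajj akk p q r s v b a l ui uj uk x z : R) :
  0 < p -> 0 < q -> 0 < r -> 0 < s -> 0 < v -> ajj <= akk ->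
  0 <= ui -> 0 <= uj -> 0 <= uk -> [|| ui != 0, uj != 0 | uk != 0] ->
  aii * ui + p * uj + q * uk = a * ui -> b * ui + ajj * uj + r * uk = a * uj ->
  s * ui + v * uj + akk * uk = a * uk ->
  (akk - aii) * (b * r) + q * b ^+ 2 - s * r ^+ 2 != 0 ->
  0 <= x -> 0 <= z -> (x != 0) || (z != 0) -> aii * x + q * z = l * x -> s * x + akk * z = l * z ->
  0 <= b * x + r * z ->
  (a - aii) * (a - ajj) - p * b + ((a - aii) * (a - akk) - q * s) + ((a - ajj) * (a - akk) - r * v) <= 0 ->
  False.
Proof.
move=> p0 q0 r0 s0 v0 jk ui0 uj0 uk0 un e1 e2 e3 cr x0 z0 xz e4 e5 sl.
have uip : 0 < ui.
  rewrite lt_def ui0 andbT; apply/eqP => h; rewrite h !mulr0 in e1.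
  have : 0 <= p * uj by rewrite mulr_ge0// ltW.
  have : 0 <= q * uk by rewrite mulr_ge0// ltW.
  move=> h1 h2; have /eqP : p * uj = 0 by lra.
  have /eqP : q * uk = 0 by lra.
  rewrite !mulf_eq0 (gt_eqF p0) (gt_eqF q0) /= => /eqP hk /eqP hj.
  by move: un; rewrite h hk hj eqxx.
have ukp : 0 < uk.
  rewrite lt_def uk0 andbT; apply/eqP => h; rewrite h !mulr0 in e3.
  have : 0 < s * ui by rewrite mulr_gt0.
  have : 0 <= v * uj by rewrite mulr_ge0// ltW.
  lra.
have ujp : 0 < uj.
  (* If [uj] were zero, [(ui, uk)] would be an eigenvector of the pair [ik] with zero slack in row
     [j], which the hypothesis on [crossG] excludes. *)
  rewrite lt_def uj0 andbT; apply/eqP => h; rewrite h !mulr0 !addr0 in e1 e2 e3.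
  case/negP: cr.
  have -> : aii = a - q * (uk / ui).
    by apply: (mulIf (lt0r_neq0 uip)); rewrite mulrBl -mulrA divfK ?gt_eqF//; lra.
  have -> : akk = a - s * (ui / uk).
    by apply: (mulIf (lt0r_neq0 ukp)); rewrite mulrBl -mulrA divfK ?gt_eqF//; lra.
  have -> : b = - (r * (uk / ui)).
    by apply: (mulIf (lt0r_neq0 uip)); rewrite mulNr -mulrA divfK ?gt_eqF//; lra.
  by apply/eqP; field; rewrite !gt_eqF.
have [ui1 uj1 uk1] : [/\ ui != 0, uj != 0 & uk != 0] by split; rewrite gt_eqF.
(* A diagonal scaling turns the eigenvector [(ui, uj, uk)] into the all-ones vector. *)
have := @scaled_triple (p * uj / ui) (q * uk / ui) (r * uk / uj) (s * ui / uk) (v * uj / uk)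
  (- b * ui / uj) (l - a) (x / ui) (z / uk).
have aiiE : aii = a - (p * uj / ui + q * uk / ui).
  by apply: (mulIf ui1); rewrite mulrBl mulrDl !divfK//; lra.
have ajjE : ajj = a + (- b * ui / uj - r * uk / uj).
  by apply: (mulIf uj1); rewrite mulrDl mulrBl !divfK//; lra.
have akkE : akk = a - (s * ui / uk + v * uj / uk).
  by apply: (mulIf uk1); rewrite mulrBl mulrDl !divfK//; lra.
move=> H le2; move: H.
rewrite !divr_gt0 ?mulr_gt0// !divr_ge0// ?(ltW uip) ?(ltW ukp)// => /(_ isT isT isT isT isT isT isT).
have -> : (x / ui != 0) || (z / uk != 0).
  by rewrite !mulf_eq0 !invr_eq0 (negPf ui1) (negPf uk1) !orbF.
move=> /(_ isT).
have -> : - b * ui / uj - r * uk / uj <= - (s * ui / uk + v * uj / uk) by lra.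
move=> /(_ isT) H; have {H} : 0 < (a - aii) * (a - ajj) - p * b + ((a - aii) * (a - akk) - q * s) +
   ((a - ajj) * (a - akk) - r * v); last by rewrite ltNge le2.
have E : (a - aii) * (a - ajj) - p * b + ((a - aii) * (a - akk) - q * s) +
   ((a - ajj) * (a - akk) - r * v) =
   - (- b * ui / uj) * (q * uk / ui + s * ui / uk + v * uj / uk)
   + r * uk / uj * (p * uj / ui + q * uk / ui + s * ui / uk)
   + p * uj / ui * (s * ui / uk) + p * uj / ui * (v * uj / uk) + q * uk / ui * (v * uj / uk).
  by rewrite aiiE ajjE akkE; field; rewrite ui1 uj1 uk1.
rewrite E; apply: H.
- rewrite (_ : - (p * uj / ui + q * uk / ui) = aii - a); last by rewrite aiiE; ring.
  transitivity ((aii * x + q * z - a * x) / ui); first by field; rewrite ui1 uk1.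
  by rewrite e4; field.
- rewrite (_ : s * ui / uk * (x / ui) - (s * ui / uk + v * uj / uk) * (z / uk) =
    s * ui / uk * (x / ui) + (akk - a) * (z / uk)); last by rewrite akkE; ring.
  transitivity ((s * x + akk * z - a * z) / uk); first by field; rewrite ui1 uk1.
  by rewrite e5; field.
- rewrite (_ : - (- b * ui / uj) * (x / ui) + r * uk / uj * (z / uk) = (b * x + r * z) / uj).
    by rewrite divr_ge0// ltW.
  by field; rewrite ui1 uj1 uk1.
Qed.

End Algebra.


(** * Sign conditions from the even positions of pairs and triples *)

Section Info.
Variables (R : rcfType) (n : nat).
Implicit Types (A : 'M[R]_n) (i j k : 'I_n) (a x y : R).

Lemma cmx_kernelP A J a (z : 'cV[R]_n) : cmx A J a *m z = 0 <->
  forall r, \sum_(k in J) A r k * z k 0 = if r \in J then a * z r 0 else z r 0.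
Proof.
split => [/colP h r|h]; first by have := h r; rewrite cmx_mulE mxE => /eqP; rewrite subr_eq0 => /eqP ->.
by apply/colP => r; rewrite cmx_mulE h mxE subrr.
Qed.

Definition pair_set i j : {set 'I_n} := finset (fun k => (k == i) || (k == j)).
Definition triple_set i j k : {set 'I_n} := finset (fun l => [|| l == i, l == j | l == k]).

Lemma sum_pair (V : nmodType) (F : 'I_n -> V) i j : i != j ->
  \sum_(k in pair_set i j) F k = F i + F j.
Proof.
move=> ij; rewrite (bigD1 i) ?inE ?eqxx//= (bigD1 j); last by rewrite inE eqxx orbT eq_sym.
rewrite big1 /= ?addr0// => k; rewrite inE => /andP[/andP[/orP[/eqP ->|/eqP ->]]]; rewrite eqxx//.
Qed.

Lemma sum_triple (V : nmodType) (F : 'I_n -> V) i j k : i != j -> i != k -> j != k ->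
  \sum_(l in triple_set i j k) F l = F i + F j + F k.
Proof.
move=> ij ik jk; rewrite (bigD1 i) ?inE ?eqxx//=.
rewrite (bigD1 j); last by rewrite inE eqxx !orbT eq_sym.
rewrite (bigD1 k); last by rewrite !inE eqxx !orbT eq_sym ik eq_sym.
rewrite big1 /= ?addr0 ?addrA// => l; rewrite inE.
by case: (l == i); case: (l == j); case: (l == k).
Qed.

Lemma card_pair i j : i != j -> #|pair_set i j| = 2%N.
Proof. by move=> ij; rewrite -sum1_card sum_pair. Qed.

Lemma card_triple i j k : i != j -> i != k -> j != k -> #|triple_set i j k| = 3%N.
Proof. by move=> ij ik jk; rewrite -sum1_card sum_triple. Qed.

Lemma pair_info A i j a : i != j -> A i j != 0 -> touched A (pair_set i j) a ->
  (0 < evens A (pair_set i j) a)%N -> exists x y,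
  [/\ [/\ 0 <= x, 0 <= y & (x != 0) || (y != 0)],
      A i i * x + A i j * y = a * x, A j i * x + A j j * y = a * y,
      forall k, k != i -> k != j -> 0 <= A k i * x + A k j * y & A i i + A j j <= 2 * a].
Proof.
move=> ij Aij [z [z0 zp /cmx_kernelP Mz]] ev.
have row r : A r i * z i 0 + A r j * z j 0 = if r \in pair_set i j then a * z r 0 else z r 0.
  by rewrite -Mz sum_pair.
have iP : i \in pair_set i j by rewrite inE eqxx.
have jP : j \in pair_set i j by rewrite inE eqxx orbT.
have ri := row i; have rj := row j; rewrite iP in ri; rewrite jP in rj.
have nz : (z i 0 != 0) || (z j 0 != 0).
  apply: contraNT z0; rewrite negb_or !negbK => /andP[/eqP hi /eqP hj].
  apply/eqP/colP => r; rewrite mxE; have := row r; rewrite hi hj !mulr0 addr0 inE.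
  case: (eqVneq r i) => [->|_]; first by rewrite hi.
  by case: (eqVneq r j) => [->|_] //= <-.
exists (z i 0), (z j 0); split => //.
  by move=> k ki kj; rewrite row inE (negPf ki) (negPf kj) /=; apply: zp.
(* By the trace, [b] is the other eigenvalue; the explicit eigenvector [v] below is nonzero because
   [A i j] is. *)
pose b := A i i + A j j - a.
have det0 : (a - A i i) * (a - A j j) = A i j * A j i.
  have r1 : (a - A i i) * z i 0 = A i j * z j 0 by rewrite mulrBl -ri; ring.
  have r2 : (a - A j j) * z j 0 = A j i * z i 0 by rewrite mulrBl -rj; ring.
  case/orP: nz => nz; apply: (mulIf nz).
    by rewrite mulrAC r1 mulrAC -mulrA r2 mulrA.
  by rewrite -mulrA r2 mulrCA r1; ring.
have /eqP : cdet A (pair_set i j) b = 0.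
  apply/eqP/negPn/negP => d0.
  pose v : 'cV[R]_n := \col_r (if r == i then A i j else if r == j then b - A i i
     else A r i * A i j + A r j * (b - A i i)).
  have vi : v i 0 = A i j by rewrite mxE eqxx.
  have vj : v j 0 = b - A i i by rewrite mxE eq_sym (negPf ij) eqxx.
  have Mv : cmx A (pair_set i j) b *m v = 0.
    apply/cmx_kernelP => r; rewrite sum_pair// vi vj inE.
    case: (eqVneq r i) => [->|ri']; first by rewrite vi; ring.
    case: (eqVneq r j) => [->|rj']; first by rewrite vj orbT /= [A j i * _]mulrC -det0 /b; ring.
    by rewrite mxE (negPf ri') (negPf rj').
  have v0 : v != 0 by apply: contraNneq Aij => v0; rewrite -vi v0 mxE.
  by case/negP: d0; apply/eqP; apply: cmx_kernel_cdet v0 Mv.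
rewrite cdet_eq0 => bR.
have [_ [_ _ _ sz _]] := rtsP A (pair_set i j); rewrite card_pair// in sz.
suff : b <= a by rewrite /b; lra.
(* The even position is the second one among at most two, so [a] is the largest eigenvalue. *)
have : all (fun c => c <= a) (rts A (pair_set i j)).
  rewrite all_count eqn_leq count_size /=; apply: leq_trans sz _.
  by move: ev; rewrite /evens; case: (count _ _) => [|[|m]]; rewrite /= ?sub0n.
by move=> /allP/(_ b bR).
Qed.

End Info.

Section Four.
Variable R : rcfType.
Implicit Types (A : 'M[R]_4) (i j k : 'I_4) (a x y : R).

Lemma det_delta_col (K : comNzRingType) m (M : 'M[K]_m.+1) (l : 'I_m.+1) : (forall r : 'I_m.+1, M r l = (r == l)%:R) ->
  \det M = \det (row' l (col' l M)).
Proof.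
move=> h; rewrite (expand_det_col _ l) (bigD1 l)//= big1 => [|r rl].
  by rewrite h eqxx mul1r addr0 /cofactor -signr_odd oddD addbb mul1r.
by rewrite h (negPf rl) mul0r.
Qed.

Lemma det33 (K : comNzRingType) (M : 'M[K]_3) (f : nat -> nat -> K) :
  (forall i j : 'I_3, M i j = f i j) ->
  \det M = f 0%N 0%N * (f 1%N 1%N * f 2%N 2%N - f 1%N 2%N * f 2%N 1%N)
   - f 0%N 1%N * (f 1%N 0%N * f 2%N 2%N - f 1%N 2%N * f 2%N 0%N)
   + f 0%N 2%N * (f 1%N 0%N * f 2%N 1%N - f 1%N 1%N * f 2%N 0%N).
Proof.
move=> h; rewrite (expand_det_row _ ord0) !big_ord_recl big_ord0.
rewrite /cofactor !(expand_det_row _ ord0) !big_ord_recl !big_ord0 /cofactor !det_mx11 !mxE !h /=.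
by rewrite /bump /=; ring.
Qed.

Definition char3 (x aii aij aik aji ajj ajk aki akj akk : R) : R :=
  (x - aii) * ((x - ajj) * (x - akk) - ajk * akj)
  - aij * (aji * (x - akk) + ajk * aki) - aik * (aji * akj + (x - ajj) * aki).

(** The column of the fourth index is a unit vector; expanding along it leaves a determinant of
    order three. *)
Lemma cdet_triple A i j k x : i != j -> i != k -> j != k -> cdet A (triple_set i j k) x =
  char3 x (A i i) (A i j) (A i k) (A j i) (A j j) (A j k) (A k i) (A k j) (A k k).
Proof.
move=> ij ik jk.
pose f (u v : nat) := A (inord u) (inord v).
have AE u v : A u v = f u v by rewrite /f !inord_val.
have main (l : 'I_4) : l != i -> l != j -> l != k -> cdet A (triple_set i j k) x =
    \det (\matrix_(u < 3, v < 3) (x *+ (u == v) - f (bump l u) (bump l v))).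
  move=> li lj lk; rewrite /cdet (det_delta_col (l := l)) => [|u]; last first.
    by rewrite mxE inE (negPf li) (negPf lj) (negPf lk).
  congr (\det _); apply/matrixP => u v; rewrite !mxE (inj_eq (@lift_inj _ l)) AE /=.
  suff -> : lift l v \in triple_set i j k by [].
  have us : uniq [:: i; j; k; l].
    by rewrite /= !inE !negb_or ij ik jk eq_sym li eq_sym lj eq_sym lk.
  have e : #|[:: i; j; k; l]| = #|'I_4| by rewrite (card_uniqP us) card_ord.
  have := elimT (subset_cardP e) (subset_predT _) (lift l v).
  by rewrite !inE (eq_sym _ l) (negPf (neq_lift l v)) orbF.
have [l /and3P[li lj lk]] : exists l, [&& l != i, l != j & l != k].
  apply/existsP; apply: contraT => /existsPn h.
  have : (#|'I_4| <= #|[:: i; j; k]|)%N.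
    apply/subset_leq_card/fintype.subsetP => l _; have := h l; rewrite !inE.
    by case: (l == i); case: (l == j); case: (l == k).
  by move=> /leq_trans/(_ (card_size _)); rewrite card_ord.
rewrite (main l li lj lk) (det33 (f := fun u v => x *+ (u == v) - f (bump l u) (bump l v))); last first.
  by move=> u v; rewrite mxE.
rewrite !AE /char3; clear main AE.
case: l li lj lk => [[|[|[|[|//]]]] ?]; case: i ij ik => [[|[|[|[|//]]]] ?];
  case: j jk => [[|[|[|[|//]]]] ?]; case: k => [[|[|[|[|//]]]] ?] //=;
  rewrite /bump /= ?mulr1n ?mulr0n => *; ring.
Qed.
Lemma triple_info A i j k a : i != j -> i != k -> j != k ->
  touched A (triple_set i j k) a -> (0 < evens A (triple_set i j k) a)%N ->
  exists ui uj uk, [/\ [/\ 0 <= ui, 0 <= uj, 0 <= uk & [|| ui != 0, uj != 0 | uk != 0]],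
    A i i * ui + A i j * uj + A i k * uk = a * ui,
    A j i * ui + A j j * uj + A j k * uk = a * uj,
    A k i * ui + A k j * uj + A k k * uk = a * uk
  & (a - A i i) * (a - A j j) - A i j * A j i + ((a - A i i) * (a - A k k) - A i k * A k i)
     + ((a - A j j) * (a - A k k) - A j k * A k j) <= 0].
Proof.
move=> ij ik jk [z [z0 zp Mz]] ev; set J := triple_set i j k in Mz ev.
have d0 := cmx_kernel_cdet z0 Mz.
move/cmx_kernelP in Mz.
have row r : A r i * z i 0 + A r j * z j 0 + A r k * z k 0 = if r \in J then a * z r 0 else z r 0.
  by rewrite -Mz sum_triple.
have iP : i \in J by rewrite inE eqxx.
have jP : j \in J by rewrite inE eqxx orbT.
have kP : k \in J by rewrite inE eqxx !orbT.
have ri := row i; have rj := row j; have rk := row k.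
rewrite iP in ri; rewrite jP in rj; rewrite kP in rk.
exists (z i 0), (z j 0), (z k 0); split => //.
  split => //; apply: contraNT z0; rewrite !negb_or !negbK => /and3P[/eqP hi /eqP hj /eqP hk].
  apply/eqP/colP => r; rewrite mxE; have := row r; rewrite hi hj hk !mulr0 !addr0 inE.
  case: (eqVneq r i) => [->|_]; first by rewrite hi.
  case: (eqVneq r j) => [->|_]; first by rewrite hj.
  by case: (eqVneq r k) => [->|_] //= <-.
have [h [pE _ hm sz od]] := rtsP A J; have [_ psz] := pcdet_monic A J.
have c3 : #|J| = 3%N by rewrite card_triple.
rewrite c3 in sz od psz.
have s3 : size (rts A J) = 3%N.
  move: ev (count_size (fun b => b <= a) (rts A J)); rewrite /evens.
  case: (size (rts A J)) sz od => [|[|[|[|m]]]] //=.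
  by case: (count _ _) => [|[|m]]; rewrite /= ?sub0n.
have h1 : h = 1.
  have hs : size h = 1%N.
    move: psz; rewrite pE size_Mmonic ?monic_neq0 ?monic_prod_XsubC// size_prod_XsubC s3.
    by rewrite addnS; case: (size h) => [|[|m]] //=; rewrite !addnS.
  have /size_poly1P[c _ hc] : size h == 1%N by rewrite hs.
  by move: hm; rewrite hc monicE lead_coefC => /eqP ->.
have aR : a \in rts A J by rewrite -cdet_eq0 d0.
have pr := perm_to_rem aR.
have : size (rem a (rts A J)) = 2%N by rewrite size_rem// s3.
case E : (rem a (rts A J)) pr => [|r [|s [|? ?]]] //= pr _.
have cE x : cdet A J x = (x - a) * ((x - r) * (x - s)).
  rewrite -pcdetE pE h1 mul1r (perm_big _ pr) !big_cons big_nil.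
  by rewrite !hornerM hornerC !hornerXsubC; ring.
have := cE (a + 1); have := cE (a - 1); rewrite !cdet_triple// => e1 e2.
(* The left-hand side is the derivative at [a] of the characteristic polynomial. For a monic cubic
   [p], [p(a + 1) - p(a - 1)] is twice this derivative plus 2. *)
have e3 : (a - A i i) * (a - A j j) - A i j * A j i + ((a - A i i) * (a - A k k) - A i k * A k i)
     + ((a - A j j) * (a - A k k) - A j k * A k j) = (a - r) * (a - s).
  have two : (2 : R) != 0 by rewrite pnatr_eq0.
  apply: (mulfI two).
  transitivity ((a + 1 - a) * ((a + 1 - r) * (a + 1 - s)) - (a - 1 - a) * ((a - 1 - r) * (a - 1 - s)) - 2).
    by rewrite -e1 -e2 /char3; ring.
  by ring.
(* As [a] occupies the second of three positions, [r] and [s] do not lie strictly on the same side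
   of it. *)
rewrite e3; move: ev; rewrite /evens !(permP pr) /= lexx ltxx.
by case: (ltgtP r a) => hr; case: (ltgtP s a) => hs //= _; nra.
Qed.

Lemma sorted_diag A : exists i1 i2 i3 i4, uniq [:: i1; i2; i3; i4] /\
  [/\ A i1 i1 <= A i2 i2, A i2 i2 <= A i3 i3 & A i3 i3 <= A i4 i4].
Proof.
pose le i j := A i i <= A j j.
have tot : total le by move=> i j; apply: le_total.
have := sort_sorted tot (enum 'I_4).
have : uniq (sort le (enum 'I_4)) by rewrite sort_uniq enum_uniq.
have : size (sort le (enum 'I_4)) = 4%N by rewrite size_sort size_enum_ord.
case: (sort le _) => [|i1 [|i2 [|i3 [|i4 [|? ?]]]]] // _ u /= /and4P[h1 h2 h3 _].
by exists i1, i2, i3, i4.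
Qed.

Lemma four_contra A : gen_mx A ->
  (forall i j, i != j -> exists2 a, touched A (pair_set i j) a & (0 < evens A (pair_set i j) a)%N) ->
  (forall i j k, i != j -> i != k -> j != k ->
    exists2 a, touched A (triple_set i j k) a & (0 < evens A (triple_set i j k) a)%N) -> False.
Proof.
move=> [off cross] pairs triples.
have pos i j : i != j -> A i i <= A j j -> 0 < A i j.
  move=> ij le; have [a ta ea] := pairs i j ij.
  have [x [y [[x0 y0 xy] e1 e2 _ tr]]] := pair_info ij (off i j ij) ta ea.
  have Aij := off i j ij; rewrite lt_def Aij /=.
  have yp : 0 < y.
    rewrite lt_def y0 andbT; apply/eqP => y00; rewrite y00 !mulr0 !addr0 in e2.
    move: e2 xy => /eqP; rewrite y00 eqxx orbF mulf_eq0 => /orP[h|->//].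
    by move: (off j i); rewrite eq_sym ij h => /(_ isT).
  have h : A i j * y = (a - A i i) * x by rewrite mulrBl -e1; ring.
  rewrite -(pmulr_lge0 _ yp) h mulr_ge0//; lra.
have neg i j k : i != j -> i != k -> j != k -> A k i < 0 -> A k j < 0 -> False.
  move=> ij ik jk h1 h2; have [a ta ea] := pairs i j ij.
  have [x [y [[x0 y0 xy] _ _ sl _]]] := pair_info ij (off i j ij) ta ea.
  have := sl k; rewrite ![k == _]eq_sym ik jk => /(_ isT isT); case/orP: xy => xy.
    have : A k i * x < 0 by rewrite nmulr_rlt0// lt_def xy.
    have : A k j * y <= 0 by rewrite nmulr_rle0.
    lra.
  have : A k i * x <= 0 by rewrite nmulr_rle0.
  have : A k j * y < 0 by rewrite nmulr_rlt0// lt_def xy.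
  lra.
(* The pair [ik] has nonnegative slack in row [j], which conflicts with the middle eigenvalue of the
   triple. *)
have both i j k : i != j -> i != k -> j != k -> A i i <= A j j -> A j j <= A k k ->
    0 < A k i -> 0 < A k j -> False.
  move=> ij ik jk lij ljk ski vkj.
  have [a ta ea] := triples i j k ij ik jk.
  have [ui [uj [uk [[u1 u2 u3 un] e1 e2 e3 le]]]] := triple_info ij ik jk ta ea.
  have [l tl el] := pairs i k ik.
  have [x [z [[x0 z0 xz] e4 e5 sl _]]] := pair_info ik (off i k ik) tl el.
  apply: (@triple_contra R (A i i) (A j j) (A k k) (A i j) (A i k) (A j k) (A k i) (A k j) (A j i)
    a l ui uj uk x z) => //.
  - exact: pos.
  - by apply: pos => //; apply: le_trans ljk.
  - exact: pos.
  - exact: cross.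
  - by apply: sl => //; rewrite eq_sym.
have [i1 [i2 [i3 [i4 [u [h12 h23 h34]]]]]] := sorted_diag A.
move: u; rewrite /= !inE !negb_or -!andbA => /and5P[d12 d13 d14 d23 /and3P[d24 d34 _]].
have h13 := le_trans h12 h23; have h24 := le_trans h23 h34.
have sg i : i != i4 -> A i4 i < 0 \/ 0 < A i4 i.
  by rewrite eq_sym => /off; case: ltgtP => //; [left|right].
have [n1|p1] := sg i1 d14; have [n2|p2] := sg i2 d24; have [n3|p3] := sg i3 d34.
- exact: (neg i1 i2 i4).
- exact: (neg i1 i2 i4).
- exact: (neg i1 i3 i4).
- exact: (both i2 i3 i4).
- exact: (neg i2 i3 i4).
- exact: (both i1 i3 i4).
- exact: (both i1 i2 i4).
- exact: (both i1 i2 i4).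
Qed.

(** Six pairs, four triples and the full set contribute 6 + 4 + 2. *)
Lemma sum_half_card : (\sum_(J : {set 'I_4}) #|J|./2 = 12)%N.
Proof.
rewrite (partition_big (fun J : {set 'I_4} => inord #|J| : 'I_5) predT)//=.
have E (k : 'I_5) : (\sum_(J : {set 'I_4} | inord #|J| == k) #|J|./2 = 'C(4, k) * k./2)%N.
  have cJ (J : {set 'I_4}) : (#|J| < 5)%N by rewrite ltnS -[X in (_ <= X)%N](card_ord 4) max_card.
  have ck (J : {set 'I_4}) : (inord #|J| == k) = (#|J| == k).
    by rewrite -val_eqE /= inordK.
  rewrite (eq_bigl (fun J : {set 'I_4} => #|J| == k)) => [|J]; last exact: ck.
  rewrite (eq_bigr (fun=> k./2)) => [|J /eqP -> //].
  by rewrite sum_nat_const -[X in 'C(X, _)](card_ord 4) -card_draws cardsE.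
by rewrite (eq_bigr _ (fun (k : 'I_5) _ => E k)) !big_ord_recl big_ord0.
Qed.

End Four.


(** * The upper bound 23 *)

Section Upper.
Variable R : rcfType.
Implicit Types (A : 'M[R]_4) (a b : R) (s : seq R).

Lemma seq_separated s : exists2 e, 0 < e & forall a b, a \in s -> b \in s -> a != b -> e <= `|a - b|.
Proof.
elim: s => [|c s [e e0 he]]; first by exists 1.
have [f f0 hf] := seq_isolated s c.
exists (Num.min e f); first by rewrite lt_min e0.
move=> a b; rewrite !inE => /orP[/eqP ->|as_] /orP[/eqP ->|bs] ab.
- by rewrite eqxx in ab.
- by rewrite ge_min distrC hf ?orbT// eq_sym.
- by rewrite ge_min hf ?orbT.
- by rewrite ge_min he.
Qed.

Lemma nearp_seq s (P : R -> R -> Prop) c : (forall a, a \in s -> nearp c (P a)) ->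
  nearp c (fun x => forall a, a \in s -> P a x).
Proof.
elim: s => [|a s IH] h; first by exists 1.
have h1 : nearp c (fun x => forall b, b \in s -> P b x).
  by apply: IH => b bs; apply: h; rewrite inE bs orbT.
apply: nearpW (nearp_and (h a (mem_head _ _)) h1) => x [ha hs] b.
by rewrite inE => /orP[/eqP -> //|]; apply: hs.
Qed.

Lemma generic_count A s : gen_mx A -> uniq s -> (forall a, a \in s -> pareto A a) -> (size s <= 23)%N.
Proof.
move=> gA us sP; rewrite leqNgt; apply/negP => sz.
have [t [ut tP tj]] := pareto_list A ord0.
have st : (24 <= size t)%N by apply: leq_trans sz (uniq_leq_size us _) => a /sP/tP.
have full J : used A t J = #|J|./2 by apply: used_full => //; rewrite sum_half_card.
apply: (four_contra gA) => [i j ij|i j k ij ik jk].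
  by apply: (@used_ex _ _ _ t); rewrite full card_pair.
by apply: (@used_ex _ _ _ t); rewrite full card_triple.
Qed.

Lemma pareto_count A s : uniq s -> (forall a, a \in s -> pareto A a) -> (size s <= 23)%N.
Proof.
move=> us sP; rewrite leqNgt; apply/negP => sz.
have [t [ut tP tj]] := pareto_list A ord0.
have st : (24 <= size t)%N by apply: leq_trans sz (uniq_leq_size us _) => a /sP/tP.
have [e e0 he] := seq_separated t.
have e20 : 0 < e / 2 by rewrite divr_gt0.
have [D gD hD] : exists2 D, gen_mx D & nearp 0 (fun x => 0 < x -> forall a, a \in t ->
    exists2 b, pareto (A + x *: D) b & `|b - a| < e / 2).
  (* At most one element [c] of [t] has zero jump. [D] keeps [c] fixed, and the others persist
     nearby because their jumps are nonzero. *)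
  have [c [D [gD hc]]] : exists c D, gen_mx D /\ ((forall x, 0 <= x -> pareto (A + x *: D) c) /\
      (forall a, a \in t -> a != c -> jump A a != 0)).
    have [[c ct jc]|h] := pselect (exists2 c, c \in t & jump A c = 0).
      have /tP[J tJ] := ct; have [D gD hD] := touched_perturb tJ.
      exists c, D; split => //; split => // a at_ ac; apply/eqP => ja.
      have := folds_le ut tP tj at_ ct ac ja jc.
      by rewrite sum_half_card ltnNge st.
    (* Without zero jump, any element of [t] can play the role of [c], and [touched_perturb] still
       supplies a generic [D]. *)
    have [a at_] : exists a, a \in t.
      by case: (t) st => // a ? _; exists a; rewrite mem_head.
    have /tP[J tJ] := at_; have [D gD hD] := touched_perturb tJ.
    exists a, D; split => //; split => // b bt _; apply/eqP => jb; apply: h; by exists b.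
  exists D => //; have [h1 h2] := hc.
  have : nearp 0 (fun x => forall a, a \in t -> 0 < x ->
      exists2 b, pareto (A + x *: D) b & `|b - a| < e / 2).
    apply: nearp_seq => a at_; have [->|ac] := eqVneq a c.
      by exists 1 => // x _ x0; exists c; [apply: h1; rewrite ltW|rewrite subrr normr0].
    by apply: nearpW (jump_persists D (h2 a at_ ac) e20).
  by apply: nearpW => x h x0 a at_; apply: h.
have [x x0 [h1 h2]] := nearp_right (nearp_and hD (gen_mx_near A gD)).
have {}h2 := h2 (negbT (gt_eqF x0)); have {}h1 := h1 x0.
have /choice[f hf] : forall a, exists b, a \in t -> pareto (A + x *: D) b /\ `|b - a| < e / 2.
  move=> a; case: (boolP (a \in t)) => [/h1[b pb ab]|_]; last by exists 0.
  by exists b.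
have finj : {in t &, injective f}.
  move=> a b at_ bt fab; apply/eqP/negPn/negP => /(he a b at_ bt).
  have [_ ha] := hf a at_; have [_ hb] := hf b bt.
  have : `|a - b| <= `|f a - a| + `|f b - b|.
    have -> : a - b = (f b - b) - (f a - a) by rewrite fab; ring.
    by rewrite [leRHS]addrC; apply: ler_normB.
  lra.
have := generic_count h2 (_ : uniq (map f t)) _.
rewrite map_inj_in_uniq// size_map => /(_ ut) h; move: st; apply/negP; rewrite -leqNgt.
by apply: h => _ /mapP[a at_ ->]; have [] := hf a at_.
Qed.

End Upper.

(** * A matrix with 23 Pareto eigenvalues *)


Section Example.
Variable R : realType.

(* Found by numerical search. *)
Definition exA : 'M[R]_4 := \matrix_(i, j)
  (nth 0 (nth [::] [:: [:: -8; 1; 14; 20]; [:: -11; 21; 22; 28];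
                       [:: -10; 24; 16; 31]; [:: -14; 35; 30; 27]] i) j : int)%:~R.

Lemma exA_vec (l x0 x1 x2 x3 : R) (w0 := (-8 - l) * x0 + x1 + 14 * x2 + 20 * x3)
    (w1 := -11 * x0 + (21 - l) * x1 + 22 * x2 + 28 * x3)
    (w2 := -10 * x0 + 24 * x1 + (16 - l) * x2 + 31 * x3)
    (w3 := -14 * x0 + 35 * x1 + 30 * x2 + (27 - l) * x3) :
  0 < x0 + x1 + x2 + x3 ->
  0 <= x0 -> 0 <= x1 -> 0 <= x2 -> 0 <= x3 ->
  0 <= w0 -> 0 <= w1 -> 0 <= w2 -> 0 <= w3 ->
  x0 * w0 + x1 * w1 + x2 * w2 + x3 * w3 = 0 -> pareto_eigenvalue exA l.
Proof.
move=> xs p0 p1 p2 p3 q0 q1 q2 q3 xw.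
pose x : 'cV[R]_4 := \col_i nth 0 [:: x0; x1; x2; x3] i.
have xE i : (exA *m x - l *: x) i 0 = nth 0 [:: w0; w1; w2; w3] i.
  rewrite !mxE !big_ord_recl big_ord0 !mxE /=.
  by case: i => [[|[|[|[|//]]]] ?] /=; rewrite ?/w0 ?/w1 ?/w2 ?/w3; ring.
exists x; split.
- apply/eqP => /colP x00; move: xs; have := x00 ord0; have := x00 (lift ord0 ord0).
  have := x00 (lift ord0 (lift ord0 ord0)); have := x00 (lift ord0 (lift ord0 (lift ord0 ord0))).
  by rewrite !mxE /= => -> -> -> ->; rewrite !addr0 ltxx.
- by case=> [[|[|[|[|//]]]] ?]; rewrite mxE.
- by move=> i; rewrite xE; case: i => [[|[|[|[|//]]]] ?].
- rewrite /inner_prod (eq_bigr (fun i : 'I_4 => nth 0 [:: x0; x1; x2; x3] i * nth 0 [:: w0; w1; w2; w3] i)).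
    by rewrite !big_ord_recl big_ord0 /= addr0 !addrA.
  by move=> i _; rewrite xE mxE.
Qed.

(** Meant for characteristic polynomials of principal submatrices; those of lower degree are padded
    with zero leading coefficients. *)
Lemma quartic_root (c0 c1 c2 c3 c4 a b : R)
    (f := fun x => c0 + c1 * x + c2 * x ^+ 2 + c3 * x ^+ 3 + c4 * x ^+ 4) :
  a < b /\ (f a < 0 /\ 0 < f b \/ 0 < f a /\ f b < 0) -> exists2 l, a < l < b & f l = 0.
Proof.
move=> [ab sg].
pose p := Poly [:: c0; c1; c2; c3; c4].
have pE x : p.[x] = f x by rewrite horner_Poly /= /f; ring.
have key q : (q = p \/ q = - p) -> q.[a] < 0 -> 0 < q.[b] -> exists2 l, a < l < b & f l = 0.
  move=> qp qa qb; have [|l /andP[al lb] /eqP ql] := @poly_ivt R q a b (ltW ab).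
    by rewrite !ltW.
  exists l; last by case: qp ql => ->; rewrite ?hornerN ?pE// => /eqP; rewrite oppr_eq0 => /eqP.
  rewrite !lt_neqAle al lb !andbT; apply/andP; split.
    by apply: contraTneq qa => ->; rewrite ql ltxx.
  by apply: contraTneq qb => <-; rewrite ql ltxx.
case: sg => -[fa fb]; [apply: (key p)|apply: (key (- p))]; rewrite ?hornerN ?pE ?oppr_lt0 ?oppr_gt0//.
  by left.
by right.
Qed.

(* In the lemmas below the vectors are columns of the adjugate of a principal submatrix of
   [l - exA], so that all the rows of the eigenvalue equation but one hold identically. *)
Lemma exA_root0 : exists2 l : R, - 13/2 < l < - 32/5 & pareto_eigenvalue exA l.
Proof.
have [|l lI e] := @quartic_root (-5796) (-5929) (-1184) (-56) 1 (- 13/2) (- 32/5); first by lra.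
exists l => //; apply: (@exA_vec l (8820 + 993 * l + l ^+ 2) (- 168 - 422 * l - 35 * l ^+ 2 + l ^+ 3) (3052 + 619 * l + 24 * l ^+ 2) (1400 + 426 * l + 35 * l ^+ 2)); nra.
Qed.

Lemma exA_root1 : exists2 l : R, - 63/10 < l < - 31/5 & pareto_eigenvalue exA l.
Proof.
have [|l lI e] := @quartic_root (-736) (-337) (-29) 1 0 (- 63/10) (- 31/5); first by lra.
exists l => //; apply: (@exA_vec l (320 + l) (12 - 8 * l + l ^+ 2) (182 + 24 * l) 0); nra.
Qed.

Lemma exA_root2 : exists2 l : R, -6 < l < -5 & pareto_eigenvalue exA l.
Proof.
have [|l lI e] := @quartic_root (-1389) (-506) (-40) 1 0 (-6) (-5); first by lra.
exists l => //; apply: (@exA_vec l (413 + 48 * l - l ^+ 2) (95 + 11 * l) 0 (91 + 14 * l)); nra.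
Qed.

Lemma exA_root3 : exists2 l : R, -5 < l < -4 & pareto_eigenvalue exA l.
Proof.
have [|l lI e] := @quartic_root (-1389) (-506) (-40) 1 0 (-5) (-4); first by lra.
exists l => //; apply: (@exA_vec l (413 + 48 * l - l ^+ 2) (95 + 11 * l) 0 (91 + 14 * l)); nra.
Qed.

Lemma exA_root4 : exists2 l : R, -4 < l < -3 & pareto_eigenvalue exA l.
Proof.
have [|l lI e] := @quartic_root (-736) (-337) (-29) 1 0 (-4) (-3); first by lra.
exists l => //; apply: (@exA_vec l (320 + l) (12 - 8 * l + l ^+ 2) (182 + 24 * l) 0); nra.
Qed.

Lemma exA_root5 : exists2 l : R, -2 < l < -1 & pareto_eigenvalue exA l.
Proof.
have [|l lI e] := @quartic_root (-5796) (-5929) (-1184) (-56) 1 (-2) (-1); first by lra.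
exists l => //; apply: (@exA_vec l (3636 + 1103 * l + 64 * l ^+ 2 - l ^+ 3) (258 + 139 * l + 11 * l ^+ 2) (971 + 218 * l + 10 * l ^+ 2) (472 + 167 * l + 14 * l ^+ 2)); nra.
Qed.

Lemma exA_root6 : exists2 l : R, -1 < l < 0 & pareto_eigenvalue exA l.
Proof.
have [|l lI e] := @quartic_root (-168) (-422) (-35) 1 0 (-1) 0; first by lra.
exists l => //; apply: (@exA_vec l (498 + 43 * l - l ^+ 2) 0 (164 + 10 * l) (76 + 14 * l)); nra.
Qed.

(** The submatrix on the first and third indices has the rational eigenvalues 2 and 6. *)
Lemma exA_at_2 : pareto_eigenvalue exA (2 : R).
Proof. by apply: (@exA_vec 2 14 0 10 0); lra. Qed.

Lemma exA_root8 : exists2 l : R, 4 < l < 5 & pareto_eigenvalue exA l.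
Proof.
have [|l lI e] := @quartic_root 64 (-19) 1 0 0 4 5; first by lra.
exists l => //; apply: (@exA_vec l (27 - l) 0 0 (14)); nra.
Qed.

Lemma exA_at_6 : pareto_eigenvalue exA (6 : R).
Proof. by apply: (@exA_vec 6 14 0 14 0); lra. Qed.

Lemma exA_root10 : exists2 l : R, 14 < l < 15 & pareto_eigenvalue exA l.
Proof.
have [|l lI e] := @quartic_root 64 (-19) 1 0 0 14 15; first by lra.
exists l => //; apply: (@exA_vec l (27 - l) 0 0 (14)); nra.
Qed.

Lemma exA_at_16 : pareto_eigenvalue exA (16 : R).
Proof. by apply: (@exA_vec 16 0 0 1 0); lra. Qed.

Lemma exA_root12 : exists2 l : R, 20 < l < 21 & pareto_eigenvalue exA l.
Proof.
have [|l lI e] := @quartic_root (-157) (-13) 1 0 0 20 21; first by lra.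
exists l => //; apply: (@exA_vec l (1) (8 + l) 0 0); nra.
Qed.

Lemma exA_at_21 : pareto_eigenvalue exA (21 : R).
Proof. by apply: (@exA_vec 21 0 1 0 0); lra. Qed.

Lemma exA_at_27 : pareto_eigenvalue exA (27 : R).
Proof. by apply: (@exA_vec 27 0 0 0 1); lra. Qed.

Lemma exA_root15 : exists2 l : R, 38 < l < 39 & pareto_eigenvalue exA l.
Proof.
have [|l lI e] := @quartic_root (-736) (-337) (-29) 1 0 38 39; first by lra.
exists l => //; apply: (@exA_vec l (192 + 37 * l - l ^+ 2) (44 + 11 * l) (54 + 10 * l) 0); nra.
Qed.

Lemma exA_root16 : exists2 l : R, 41 < l < 42 & pareto_eigenvalue exA l.
Proof.
have [|l lI e] := @quartic_root (-192) (-37) 1 0 0 41 42; first by lra.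
exists l => //; apply: (@exA_vec l 0 (- 16 + l) (24) 0); nra.
Qed.

Lemma exA_root17 : exists2 l : R, 44 < l < 45 & pareto_eigenvalue exA l.
Proof.
have [|l lI e] := @quartic_root (-168) (-422) (-35) 1 0 44 45; first by lra.
exists l => //; apply: (@exA_vec l (498 + 43 * l - l ^+ 2) 0 (164 + 10 * l) (76 + 14 * l)); nra.
Qed.

Lemma exA_root18 : exists2 l : R, 50 < l < 51 & pareto_eigenvalue exA l.
Proof.
have [|l lI e] := @quartic_root (-1389) (-506) (-40) 1 0 50 51; first by lra.
exists l => //; apply: (@exA_vec l (413 + 48 * l - l ^+ 2) (95 + 11 * l) 0 (91 + 14 * l)); nra.
Qed.

Lemma exA_root19 : exists2 l : R, 52 < l < 53 & pareto_eigenvalue exA l.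
Proof.
have [|l lI e] := @quartic_root (-498) (-43) 1 0 0 52 53; first by lra.
exists l => //; apply: (@exA_vec l 0 0 (- 27 + l) (30)); nra.
Qed.

Lemma exA_root20 : exists2 l : R, 55 < l < 56 & pareto_eigenvalue exA l.
Proof.
have [|l lI e] := @quartic_root (-413) (-48) 1 0 0 55 56; first by lra.
exists l => //; apply: (@exA_vec l 0 (- 27 + l) 0 (35)); nra.
Qed.

Lemma exA_root21 : exists2 l : R, 73 < l < 74 & pareto_eigenvalue exA l.
Proof.
have [|l lI e] := @quartic_root (-5796) (-5929) (-1184) (-56) 1 73 74; first by lra.
exists l => //; apply: (@exA_vec l (3636 + 1103 * l + 64 * l ^+ 2 - l ^+ 3) (258 + 139 * l + 11 * l ^+ 2) (971 + 218 * l + 10 * l ^+ 2) (472 + 167 * l + 14 * l ^+ 2)); nra.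
Qed.

Lemma exA_root22 : exists2 l : R, 78 < l < 79 & pareto_eigenvalue exA l.
Proof.
have [|l lI e] := @quartic_root (-3636) (-1103) (-64) 1 0 78 79; first by lra.
exists l => //; apply: (@exA_vec l 0 (- 498 - 43 * l + l ^+ 2) (437 + 24 * l) (160 + 35 * l)); nra.
Qed.


End Example.

(** * The Pareto capacity of order four *)


(** The terms of the inner product are nonnegative, so each of them vanishes. [J] is the support of
    [x], and [z] equals [x] on it and the slack elsewhere. *)
Lemma pareto_eigenvalue_pareto (R : realType) n (A : 'M[R]_n) l :
  pareto_eigenvalue A l -> pareto A l.
Proof.
move=> [x [x0 xp wp xw]]; set w := A *m x - l *: x in wp xw.
have xw0 i : x i 0 * w i 0 = 0.
  apply/eqP; have /eqP := xw; rewrite /inner_prod psumr_eq0; last first.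
    by move=> k _; apply: mulr_ge0; [apply: xp|apply: wp].
  by move=> /allP/(_ i); rewrite mem_index_enum => /(_ isT).
pose J := finset (fun i => x i 0 != 0).
pose z : 'cV[R]_n := \col_i (if i \in J then x i 0 else w i 0).
have zJ i : i \in J -> z i 0 = x i 0 by move=> iJ; rewrite mxE iJ.
exists J, z; split.
- apply: contraNneq x0 => z0; apply/eqP/colP => i; rewrite mxE.
  have [iJ|] := boolP (i \in J); first by rewrite -zJ// z0 mxE.
  by rewrite inE negbK => /eqP.
- by move=> i; rewrite mxE; case: ifP => _; [apply: xp|apply: wp].
apply/cmx_kernelP => r.
have -> : \sum_(k in J) A r k * z k 0 = l * x r 0 + w r 0.
  have -> : l * x r 0 + w r 0 = (A *m x) r 0.
    have -> : A *m x = l *: x + w by rewrite /w addrC subrK.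
    by rewrite [RHS]mxE [X in _ = X + _]mxE.
  rewrite mxE [RHS](bigID (mem J)) /= [X in _ = _ + X]big1 ?addr0.
    by apply: eq_bigr => k kJ; rewrite zJ.
  by move=> k; rewrite inE negbK => /eqP ->; rewrite mulr0.
case: ifP => rJ.
  rewrite zJ//; have /eqP := xw0 r; rewrite mulf_eq0 => /orP[h|/eqP ->]; last by rewrite addr0.
  by move: rJ; rewrite inE h.
by rewrite [RHS]mxE rJ; move: rJ; rewrite inE => /negbFE/eqP ->; rewrite mulr0 add0r.
Qed.

Local Open Scope classical_set_scope.
Local Open Scope card_scope.

Lemma card_le_uniq (T : choiceType) (S : set T) n :
  (forall s : seq T, uniq s -> (forall a, a \in s -> S a) -> (size s <= n)%N) -> S #<= `I_n.
Proof.
move=> h; have [/finite_fsetP[X SX]|/(@infinite_set_fset _ _ n.+1)[B BS sB]] := pselect (finite_set S).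
  have /card_eq_fsetP e : #|` X| = #|` X| by [].
  rewrite SX (card_le_eql e) card_le_II; apply: h; first exact: fset_uniq.
  by move=> a aX; rewrite SX.
have : (size (enum_fset B) <= n)%N by apply: h; [apply: fset_uniq|move=> a aB; apply: BS].
by rewrite leqNgt sB.
Qed.

Lemma card_ge_uniq (T : choiceType) (S : set T) (s : seq T) :
  uniq s -> (forall a, a \in s -> S a) -> `I_(size s) #<= S.
Proof.
move=> us sS; have /card_eq_fsetP e : #|` seq_fset tt s| = size s by rewrite size_seq_fset undup_id.
rewrite -(card_le_eql e); apply: subset_card_le => a /= aX.
by apply: sS; rewrite -(seq_fsetE tt).
Qed.

Lemma spectrum_le23 (R : realType) (A : 'M[R]_4) : pareto_spectrum A #<= `I_23.
Proof.
apply: card_le_uniq => s us sP; apply: (@pareto_count R A s us) => a /sP.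
exact: pareto_eigenvalue_pareto.
Qed.

(** The whole matrix provides three eigenvalues, the triples nine, the pairs eight and the single
    indices three. Disjoint isolating intervals make the list strictly increasing. *)
Lemma exA_spectrum (R : realType) : exists2 s : seq R, size s = 23%N &
  uniq s /\ forall a, a \in s -> pareto_spectrum (exA R) a.
Proof.
have [l0 i0 p0] := exA_root0 R; have [l1 i1 p1] := exA_root1 R; have [l2 i2 p2] := exA_root2 R.
have [l3 i3 p3] := exA_root3 R; have [l4 i4 p4] := exA_root4 R; have [l5 i5 p5] := exA_root5 R.
have [l6 i6 p6] := exA_root6 R; have [l8 i8 p8] := exA_root8 R; have [l10 i10 p10] := exA_root10 R.
have [l12 i12 p12] := exA_root12 R; have [l15 i15 p15] := exA_root15 R; have [l16 i16 p16] := exA_root16 R.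
have [l17 i17 p17] := exA_root17 R; have [l18 i18 p18] := exA_root18 R; have [l19 i19 p19] := exA_root19 R.
have [l20 i20 p20] := exA_root20 R; have [l21 i21 p21] := exA_root21 R; have [l22 i22 p22] := exA_root22 R.
exists [:: l0; l1; l2; l3; l4; l5; l6; 2; l8; 6; l10; 16; l12; 21; 27; l15; l16; l17; l18; l19; l20; l21; l22] => //.
split.
  apply: (@sorted_uniq _ <%R); [exact: lt_trans|exact: ltxx|].
  by rewrite /=; do ![apply/andP; split]; lra.
have at2 := exA_at_2 R; have at6 := exA_at_6 R; have at16 := exA_at_16 R.
have at21 := exA_at_21 R; have at27 := exA_at_27 R.
move=> a; rewrite !inE.
by do ![case/orP => [/eqP -> //|]]; move=> /eqP ->.
Qed.

Theorem theorem1p1 (R : realType) :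
  [/\ (forall A : 'M[R]_4, pareto_spectrum A #<= `I_23),
      (exists A : 'M[R]_4, pareto_spectrum A #= `I_23)
    & pareto_capacity R 4 = 23%N].
Proof.
have attained : exists A : 'M[R]_4, pareto_spectrum A #= `I_23.
  exists (exA R); have [s sz [us sP]] := exA_spectrum R.
  by rewrite card_eq_le spectrum_le23 -sz card_ge_uniq.
split => //; first exact: spectrum_le23.
(* The capacity is unique: each candidate bounds the spectrum attaining the other. *)
apply: xget_unique; first by split => //; apply: spectrum_le23.
move=> c [cle [A Ac]]; apply/eqP; rewrite eqn_leq; apply/andP; split.
  by rewrite -card_le_II -(card_le_eql Ac) spectrum_le23.
by have [B B23] := attained; rewrite -card_le_II -(card_le_eql B23).
Qed.
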